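(* In the setting described in the context (with $\xi$ an arbitrary $\mathbb{R}^d$-valued Lévy process independent of $Y$, on which nothing further is assumed), assume that there exists $\delta>0$ such that \[ \int_0^\delta \mathbb{E}\, T_s^{-1/2}\,ds < \infty, \] and that $b \in C_b(\mathbb{R}^d;\mathbb{R}^d)$. Then $P^X_t$ is strong Feller for every $t>0$.
   Context: $W$ is a standard $\mathbb{R}^d$-valued Wiener process (identity covariance). A subordinator is an increasing Lévy process $T:\mathbb{R}_+\to\mathbb{R}_+$ with $T_0=0$ and $T_t>0$ for $t>0$; $T$ is independent of $W$, and $Y_t := W_{T_t}$. $\xi$ is an $\mathbb{R}^d$-valued Lévy process independent of $Y$, and $Z := Y+\xi$. Standing assumption: for each $x\in\mathbb{R}^d$ the SDE $dX_t=b(X_t)\,dt+dZ_t$, $X_0=x$, has a Markovian weak solution $X^x$, and the transition semigroup $P^X_t f(x) := \mathbb{E} f(X^x_t)$, $f\in\mathscr{B}_b(\mathbb{R}^d)$, is Feller for all $t\geq 0$, i.e. $P^X_t$ maps $C_b(\mathbb{R}^d)$ into $C_b(\mathbb{R}^d)$. $\mathscr{B}_b(\mathbb{R}^d)$ denotes bounded Borel functions, $C_b(\mathbb{R}^d)$ bounded continuous functions. A sub-Markovian operator $A$ on $\mathscr{B}_b(\mathbb{R}^d)$ is strong Feller if $A(\mathscr{B}_b(\mathbb{R}^d))\subseteq C_b(\mathbb{R}^d)$. *)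

(* Defs.v *)
(* R^d is rendered as row vectors 'rV[R]_d
   (with the sup-norm topology of mathcomp-analysis, which is the usual
   topology of R^d).  Processes are functions  R -> Omega -> value,
   only times t >= 0 being relevant. *)
From HB Require Import structures.
From mathcomp Require Import all_boot all_order all_algebra.
From mathcomp Require Import all_classical all_reals all_analysis.
Set Implicit Arguments. Unset Strict Implicit. Unset Printing Implicit Defensive.
Import Order.TTheory GRing.Theory Num.Theory.
Import numFieldNormedType.Exports.
Local Open Scope classical_set_scope.
Local Open Scope ring_scope.

Definition borelV {R : realType} (d : nat) : set (set 'rV[R]_d) :=
  <<s [set A | open A] >>.
Arguments borelV {R} d.

Section Defs.
Context {R : realType}.

Definition bounded_fun {U : normedModType R} {S : Type} (f : S -> U) :=
  exists M : R, forall x, `|f x| <= M.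

Definition Bb (d : nat) (f : 'rV[R]_d -> R) :=
  bounded_fun f /\
  forall B : set R, measurable B -> borelV d (f @^-1` B).

Definition Cb (d : nat) {U : normedModType R} (f : 'rV[R]_d -> U) :=
  continuous f /\ bounded_fun f.

Definition Feller (d : nat) (A : ('rV[R]_d -> R) -> ('rV[R]_d -> R)) :=
  forall f, Cb f -> Cb (A f).
Definition strong_Feller (d : nat) (A : ('rV[R]_d -> R) -> ('rV[R]_d -> R)) :=
  forall f, Bb f -> Cb (A f).

Section Proc.
Context {dO : measure_display} {Om : measurableType dO} (P : probability Om R).
Context {U : normedModType R} (M : set (set U)).
(* M is the sigma-algebra on the state space U: borelV d on R^d,
   the (Borel) measurable sets on R *)

Definition rv_process (X : R -> Om -> U) :=
  forall t, 0 <= t -> forall B, M B -> measurable (X t @^-1` B).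

(* finite-dimensional (cylinder) events of a process: these generate the
   sigma-algebra sigma(X_t, t >= 0) and form a pi-system *)
Definition fd_event (X : R -> Om -> U) (A : set Om) :=
  exists n (ts : nat -> R) (Bs : nat -> set U),
    (forall k, 0 <= ts k) /\ (forall k, M (Bs k)) /\
    A = \bigcap_(k < n) (X (ts k) @^-1` Bs k).

Definition cadlag (f : R -> U) :=
  (forall t, 0 <= t -> f x @[x --> t^'+] --> f t) /\
  (forall t, 0 < t -> cvg (f x @[x --> t^'-])).

(* Levy process (Sato's definition) *)
Definition levy_process (X : R -> Om -> U) :=
  [/\ rv_process X,
      {ae P, forall w, X 0 w = 0} &
      [/\
      (forall n (ts : nat -> R) (Bs : nat -> set U),
          0 <= ts 0%N -> (forall k, ts k <= ts k.+1) -> (forall k, M (Bs k)) ->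
          P (\bigcap_(k < n) [set w | Bs k (X (ts k.+1) w - X (ts k) w)]) =
          (\prod_(k < n) P [set w | Bs k (X (ts k.+1) w - X (ts k) w)%R])%E),
      (forall s t B, 0 <= s -> s <= t -> M B ->
          P [set w | B (X t w - X s w)] = P [set w | B (X (t - s) w)]),
      (forall (t eps : R) (u : R^nat), 0 <= t -> 0 < eps ->
          (forall n, 0 <= u n) -> u n @[n --> \oo] --> t ->
          P [set w | eps < `|X (u n) w - X t w|] @[n --> \oo] --> 0%E)
    &
      {ae P, forall w, cadlag (fun t => X t w)}]].

End Proc.

(* independence of two families of events (applied to the generating
   pi-systems fd_event of two processes) *)
Definition indep_events {dO : measure_display} {Om : measurableType dO}
  (P : probability Om R) (G1 G2 : set (set Om)) :=
  forall A B, G1 A -> G2 B -> P (A `&` B) = (P A * P B)%E.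

(* equality of finite-dimensional distributions (= equality of laws on
   path space) of two R^d-valued processes on possibly different spaces *)
Definition same_law {d : nat}
  {d1 : measure_display} {O1 : measurableType d1} (P1 : probability O1 R)
  (X1 : R -> O1 -> 'rV[R]_d)
  {d2 : measure_display} {O2 : measurableType d2} (P2 : probability O2 R)
  (X2 : R -> O2 -> 'rV[R]_d) :=
  forall n (ts : nat -> R) (Bs : nat -> set 'rV[R]_d),
    (forall k, 0 <= ts k) -> (forall k, borelV d (Bs k)) ->
    P1 (\bigcap_(k < n) (X1 (ts k) @^-1` Bs k)) =
    P2 (\bigcap_(k < n) (X2 (ts k) @^-1` Bs k)).

Definition dotV {d : nat} (u v : 'rV[R]_d) : R := \sum_(i < d) u 0 i * v 0 i.

(* standard R^d-valued Wiener process (identity covariance):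
   Levy process, a.s. continuous paths, W_t ~ N(0, t I)
   (Gaussian law given through its characteristic function
    E exp(i<u,W_t>) = exp(-t|u|^2/2)) *)
Definition wiener {d : nat} {dO : measure_display} {Om : measurableType dO}
  (P : probability Om R) (W : R -> Om -> 'rV[R]_d) :=
  [/\ levy_process P (borelV d) W,
      {ae P, forall w, {in [set t | 0 <= t], continuous (fun t => W t w)}}
    & forall t (u : 'rV[R]_d), 0 <= t ->
        (\int[P]_w (cos (dotV u (W t w)))%:E)%E = (expR (- (t * dotV u u) / 2)%R)%:E
        /\ (\int[P]_w (sin (dotV u (W t w)))%:E)%E = 0%E].

Definition subordinator {dO : measure_display} {Om : measurableType dO}
  (P : probability Om R) (T : R -> Om -> R) :=
  levy_process P (@measurable _ R) T /\
  {ae P, forall w, [/\ T 0 w = 0,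
                      (forall s t, 0 <= s -> s <= t -> T s w <= T t w)
                    & forall t, 0 < t -> 0 < T t w]}.

Definition filtration {dO : measure_display} {Om : measurableType dO}
  (F : R -> set (set Om)) :=
  [/\ forall t, sigma_algebra setT (F t),
      forall t, F t `<=` measurable
    & forall s t, 0 <= s -> s <= t -> F s `<=` F t].

Definition adapted {d : nat} {dO : measure_display} {Om : measurableType dO}
  (F : R -> set (set Om)) (X : R -> Om -> 'rV[R]_d) :=
  forall t B, 0 <= t -> borelV d B -> F t (X t @^-1` B).

Definition F_levy {d : nat} {dO : measure_display} {Om : measurableType dO}
  (P : probability Om R) (F : R -> set (set Om)) (Z : R -> Om -> 'rV[R]_d) :=
  [/\ levy_process P (borelV d) Z, adapted F Z
    & forall s t A B, 0 <= s -> s <= t -> F s A -> borelV d B ->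
        P (A `&` [set w | B (Z t w - Z s w)]) =
        (P A * P [set w | B (Z t w - Z s w)%R])%E].

Definition vint {d : nat} (t : R) (g : R -> 'rV[R]_d) : 'rV[R]_d :=
  \row_i fine (\int[@lebesgue_measure R]_(s in `[0%R, t]) (g s 0 i)%:E)%E.

Definition PX {d : nat} (dO : 'rV[R]_d -> measure_display)
  (Om : forall x, measurableType (dO x))
  (Px : forall x, probability (Om x) R)
  (X : forall x, R -> Om x -> 'rV[R]_d) (t : R) (f : 'rV[R]_d -> R)
  : 'rV[R]_d -> R :=
  fun x => fine (\int[Px x]_w (f (X x t w))%:E)%E.

(* (Om x, F x, Px x, Z' x, X x) is a Markovian weak solution of
   dX_t = b(X_t) dt + dZ_t, X_0 = x, for every x, where Z (on the space
   (Om0, P0)) is the driving noise; the Markov property is w.r.t. the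
   filtration and with the transition semigroup PX of the family. *)
Definition markov_weak_solutions {d : nat}
  (b : 'rV[R]_d -> 'rV[R]_d)
  {d0 : measure_display} {Om0 : measurableType d0} (P0 : probability Om0 R)
  (Z : R -> Om0 -> 'rV[R]_d)
  (dO : 'rV[R]_d -> measure_display) (Om : forall x, measurableType (dO x))
  (Px : forall x, probability (Om x) R) (F : forall x, R -> set (set (Om x)))
  (Z' : forall x, R -> Om x -> 'rV[R]_d) (X : forall x, R -> Om x -> 'rV[R]_d) :=
  forall x,
  [/\ filtration (F x),
      F_levy (Px x) (F x) (Z' x),
      same_law (Px x) (Z' x) P0 Z &
  [/\
      adapted (F x) (X x),
      {ae Px x, forall w, cadlag (fun t => X x t w)},
      {ae Px x, forall w, forall t, 0 <= t ->
          X x t w = x + vint t (fun s => b (X x s w)) + Z' x t w}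
    &
      forall s t A f, 0 <= s -> 0 <= t -> F x s A -> Bb f ->
        (\int[Px x]_(w in A) (f (X x (s + t) w))%:E)%E =
        (\int[Px x]_(w in A) (PX Px X t f (X x s w))%:E)%E]].

End Defs.

(* Main.v *)
(** Write [Z_s] for the driving noise, [Q_s g x = E g(x + Z_s)] and [phi s = E T_s^(-1/2)].

    Conditionally on [T_s] the noise has a Gaussian component of variance [T_s], and translating a
    Gaussian vector of variance [tau] by [v] changes its law by [O(|v| / sqrt tau)] in total
    variation; hence [Q_s] maps bounded functions to functions with Lipschitz constant
    [O(phi s)].  As [phi] is nonincreasing and integrable near [0], it is finite there.

    On a small interval of length [eta] the solution differs from its initial value plus the noise
    increment by at most [|b| eta], so that telescoping [E_x (Q_(h-r) g) (X_(t-h+r))] along a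
    partition of [0 <= r <= h] gives
    [|E_x g(X_t) - E_x (Q_h g)(X_(t-h))| <= C |b| int_0^h phi] for Lipschitz [0 <= g <= 1].
    By regularity of Borel measures the same bound holds for indicators [g] of Borel sets.
    There [Q_h g] is bounded and continuous, so by the Feller property [P_t g] is a uniform
    limit, as [h -> 0], of the continuous functions [P_(t-h) (Q_h g)]. *)
Require Import Defs.
From HB Require Import structures.
From mathcomp Require Import all_boot all_order all_algebra.
From mathcomp Require Import all_classical all_reals all_analysis.
From mathcomp Require Import measurable_realfun ring lra.
Set Implicit Arguments.
Unset Strict Implicit.
Unset Printing Implicit Defensive.
Import Order.TTheory GRing.Theory Num.Theory.
Import numFieldNormedType.Exports.
Local Open Scope classical_set_scope.
Local Open Scope ring_scope.

(** The obstacle is that phi may blow up at 0, so the last step before time t cannot rely on the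
    smoothing by the noise. There the Lipschitz constant of g itself is spent; it is multiplied by
    the mesh and disappears in the limit. The final bound is thus independent of that constant,
    which is what the passage to indicators needs, and uniform in x, which is what makes the limit
    continuous.

    The Gaussian law of [W t] is given only by its characteristic function, so no density on R^d is
    at hand. Translations are reduced to dimension one: replacing the component along a unit vector
    e by an independent normal variable of mean k produces the law translated by k e, because the
    characteristic functions agree. That these determine expectations of bounded Lipschitz functions
    is shown by explicit trigonometric polynomials. The constant 9 comes from comparing two normal
    densities on the line, the factor d + 1 from comparing Euclidean and sup norms.

    Independence of T and W is available only at fixed times of W, so W at time T_s is reached by
    rounding T_s to a grid and using continuity of paths. *)

Local Notation borel_rV R d := (g_sigma_algebraType [set A : set 'rV[R]_d | open A]).

(** * Random vectors and expectations *)

Section random_vectors.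
Context {R : realType}.

Lemma dist_lt_itv (a q e : R) : a - e < q -> q < a + e -> `|a - q| < e.
Proof. by move=> h1 h2; rewrite ltr_norml; apply/andP; split; lra. Qed.

Lemma rV_coord_le d (x : 'rV[R]_d) i : `|x 0 i| <= `|x|.
Proof. by rewrite [leRHS]/(Num.norm _)/= mx_normrE; apply: (le_bigmax _ _ (0, i)). Qed.

Lemma rV_norm_le d (x : 'rV[R]_d) e : 0 <= e -> (forall i, `|x 0 i| <= e) -> `|x| <= e.
Proof.
move=> e0 xe; rewrite [leLHS]/(Num.norm _)/= mx_normrE; apply: bigmax_le => // -[i j] _ /=.
by rewrite ord1.
Qed.

Lemma rV_norm_lt d (x : 'rV[R]_d) e : 0 < e -> (forall i, `|x 0 i| < e) -> `|x| < e.
Proof.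
move=> e0 xe; rewrite [ltLHS]/(Num.norm _)/= mx_normrE; apply: bigmax_lt => // -[i j] _ /=.
by rewrite ord1.
Qed.

Lemma rV_norm_le_sum d (x : 'rV[R]_d) : `|x| <= \sum_i `|x 0 i|.
Proof.
apply: rV_norm_le => [|i]; first exact: sumr_ge0.
by rewrite (bigD1 i)//= lerDl sumr_ge0.
Qed.

(** Phrased with the [borelV] of the setting; [rvec_measurable_fun] is the bridge to the
    measurability of the library, with [borel_rV] as target. *)
Definition rvec d {dO} {Om : measurableType dO} (V : Om -> 'rV[R]_d) :=
  forall B, borelV d B -> measurable (V @^-1` B).


Lemma rvec_measurable_fun d dO (Om : measurableType dO) (V : Om -> 'rV[R]_d) :
  rvec V <-> measurable_fun setT (V : Om -> borel_rV R d).
Proof.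
split=> [h _ B mB|h B mB]; first by rewrite setTI; exact: h.
by rewrite -[X in measurable X]setTI; apply: h.
Qed.

Lemma borelV_open d (A : set 'rV[R]_d) : open A -> borelV d A.
Proof. by move=> oA; apply: sub_sigma_algebra. Qed.

Lemma rvec_open d dO (Om : measurableType dO) (V : Om -> 'rV[R]_d) :
  (forall A, open A -> measurable (V @^-1` A)) -> rvec V.
Proof.
move=> h; apply/rvec_measurable_fun.
apply: (@measurability _ _ Om (borel_rV R d) setT V [set A : set 'rV[R]_d | open A]) => // _ [A oA <-].
by rewrite setTI; exact: h.
Qed.

(** An open set is a countable union of sup-norm cubes with rational centres and radii [1/(k+1)],
    and the preimage of a cube is a finite intersection of conditions on the coordinates. *)
Lemma rvec_coord d dO (Om : measurableType dO) (V : Om -> 'rV[R]_d) :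
  (forall i, measurable_fun setT (fun w => V w 0 i)) -> rvec V.
Proof.
move=> mV; apply: rvec_open => A oA.
pose c (q : 'rV[rat]_d) : 'rV[R]_d := map_mx ratr q.
pose B (qk : 'rV[rat]_d * nat) := [set x : 'rV[R]_d | forall i, `|x 0 i - c qk.1 0 i| < qk.2.+1%:R^-1].
pose F qk := if `[< B qk `<=` A >] then V @^-1` B qk else set0.
have -> : V @^-1` A = \bigcup_qk F qk.
  apply/seteqP; split => w /=; last first.
    by move=> [qk _]; rewrite /F; case: asboolP => // BA /BA.
  move=> Aw; have /nbhs_ballP[e /= e0 eA] : nbhs (V w) A by exact: open_nbhs_nbhs.
  have [k ke] : exists k, k.+1%:R^-1 < e / 2.
    have := near_infty_natSinv_lt (PosNum (divr_gt0 e0 (ltr0n _ 2))).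
    by case=> k _ /(_ k (leqnn k)) /= ?; exists k.
  have k0 : 0 < k.+1%:R^-1 :> R by rewrite invr_gt0.
  have qi i : exists q : rat, `|V w 0 i - ratr q| < k.+1%:R^-1.
    have lt2 : V w 0 i - k.+1%:R^-1 < V w 0 i + k.+1%:R^-1 by rewrite ltrD2l gtrN.
    have [q] := rat_in_itvoo lt2.
    by rewrite in_itv/= => /andP[a b]; exists q; exact: dist_lt_itv.
  have /choice[q hq] := qi.
  exists (\row_i q i, k) => //.
  have Bw : B (\row_i q i, k) (V w) by move=> i /=; rewrite /c !mxE.
  rewrite /F; case: asboolP => // -[] x Bx; apply: eA; rewrite -ball_normE /ball_ /=.
  apply: rV_norm_lt => // i; rewrite !mxE.
  move: (Bx i) (Bw i) => /=; set t := c _ 0 i => h1 h2.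
  have -> : V w 0 i - x 0 i = (V w 0 i - t) - (x 0 i - t) by ring.
  by apply: le_lt_trans (ler_normB _ _) _; rewrite [ltRHS]splitr; apply: ltrD; apply: lt_trans ke.
apply: countable_bigcupT_measurable => // -[q k].
rewrite /F; case: asboolP => // _.
have -> : V @^-1` B (q, k) = \big[setI/setT]_(i < d) [set w | `|V w 0 i - c q 0 i| < k.+1%:R^-1].
  apply/seteqP; split => w /= h; first by rewrite -bigcap_seq => i _; exact: h.
  by move: h; rewrite -bigcap_seq => h i; apply: h; rewrite /= mem_index_enum.
apply: bigsetI_measurable => i _.
rewrite -[X in measurable X]setTI.
have -> : [set w | `|V w 0 i - c q 0 i| < k.+1%:R^-1] = (fun w => `|V w 0 i - c q 0 i|) @^-1` `]-oo, k.+1%:R^-1[%classic.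
  by apply/seteqP; split => w /=; rewrite in_itv.
suff : measurable_fun setT (fun w => `|V w 0 i - c q 0 i|) by apply.
apply: measurableT_comp => //; apply: measurable_funB => //.
Qed.

Lemma continuous_borelV d (f : 'rV[R]_d -> R) : continuous f -> measurable_fun setT (f : borel_rV R d -> R).
Proof.
move=> cf; apply: (measurability _ (RGenOpens.measurableE R)).
move=> _ [_ [a [b ->]] <-]; rewrite setTI; apply: borelV_open.
by move/continuousP : cf; apply; exact: interval_open.
Qed.

Lemma rvec_comp d dO (Om : measurableType dO) (V : Om -> 'rV[R]_d) (f : 'rV[R]_d -> R) :
  measurable_fun setT (f : borel_rV R d -> R) -> rvec V -> measurable_fun setT (fun w => f (V w)).
Proof. by move=> mf /rvec_measurable_fun; exact: measurableT_comp. Qed.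

Lemma coord_rvec d dO (Om : measurableType dO) (V : Om -> 'rV[R]_d) i :
  rvec V -> measurable_fun setT (fun w => V w 0 i).
Proof. by apply: (rvec_comp (f := fun x => x 0 i)); apply: continuous_borelV; exact: coord_continuous. Qed.

Lemma rvecD d dO (Om : measurableType dO) (V U : Om -> 'rV[R]_d) :
  rvec V -> rvec U -> rvec (fun w => V w + U w).
Proof.
move=> rV rU; apply: rvec_coord => i.
under eq_fun do rewrite mxE.
by apply: measurable_funD; exact: coord_rvec.
Qed.

Lemma rvecB d dO (Om : measurableType dO) (V U : Om -> 'rV[R]_d) :
  rvec V -> rvec U -> rvec (fun w => V w - U w).
Proof.
move=> rV rU; apply: rvec_coord => i.
under eq_fun do rewrite !mxE.
by apply: measurable_funB; exact: coord_rvec.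
Qed.

Lemma rvec_cst d dO (Om : measurableType dO) (x : 'rV[R]_d) : rvec (fun _ : Om => x).
Proof. by apply: rvec_coord => i; exact: measurable_cst. Qed.

Lemma rvec_measurableT_comp d dO (Om : measurableType dO) dO' (Om' : measurableType dO')
    (V : Om -> 'rV[R]_d) (h : Om' -> Om) :
  rvec V -> measurable_fun setT h -> rvec (V \o h).
Proof.
by move=> /rvec_measurable_fun mV mh; apply/rvec_measurable_fun; exact: measurableT_comp.
Qed.

Section expectation.
Context {dO : measure_display} {Om : measurableType dO} (P : probability Om R).
Implicit Types (f g : Om -> R) (M c : R).

Lemma bounded_integrable f M : measurable_fun setT f -> (forall w, `|f w| <= M) ->
  P.-integrable setT (EFin \o f).
Proof.
move=> mf fM; apply: measurable_bounded_integrable => //.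
  by have -> : (P : {measure set Om -> \bar R}) setT = 1%E := probability_setT P; rewrite ltry.
exists M; split; first exact: num_real.
by move=> x Mx w _ /=; apply: le_trans (fM w) (ltW Mx).
Qed.

Lemma Rexpectation_cst (c : R) : \int[P]_w c = c.
Proof. rewrite Rintegral_cst//.
by have -> : (P : {measure set Om -> \bar R}) setT = 1%E := probability_setT P; rewrite /= mulr1. Qed.

(** [M] gives integrability. The bound [c] holds merely almost surely; replacing [|f|] by its
    minimum with [c] keeps the integral and makes the bound pointwise. *)
Lemma norm_expectation_le f M c : measurable_fun setT f -> (forall w, `|f w| <= M) ->
  {ae P, forall w, `|f w| <= c} -> `|\int[P]_w f w| <= c.
Proof.
move=> mf fM fc.
apply: le_trans (le_normr_Rintegral _ (bounded_integrable mf fM)) _ => //.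
have -> : \int[P]_w `|f w| = \int[P]_w Num.min `|f w| c.
  congr fine; apply: ae_eq_integral => //.
  - by apply/measurable_EFinP; exact: measurableT_comp.
  - by apply/measurable_EFinP; apply: measurable_minr => //; exact: measurableT_comp.
  - by apply: filterS fc => w h _ /=; congr EFin; apply/esym/min_idPl.
rewrite -[leRHS]Rexpectation_cst; apply: le_Rintegral => //.
- apply: (@bounded_integrable _ (M + `|c|)) => [|w]; first by apply: measurable_minr => //; exact: measurableT_comp.
  rewrite /Num.min; case: ifP => _; rewrite ?normr_id; last by rewrite ler_wpDl// (le_trans _ (fM w)).
  by rewrite (le_trans (fM w))// lerDl.
- apply: (@bounded_integrable _ `|c|) => //.
- by move=> w _; rewrite ge_min lexx orbT.
Qed.

Lemma norm_expectation_le_bound f M : measurable_fun setT f -> (forall w, `|f w| <= M) ->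
  `|\int[P]_w f w| <= M.
Proof. by move=> mf fM; apply: (norm_expectation_le mf fM); exact: aeW. Qed.

Lemma RexpectationB f g M : measurable_fun setT f -> measurable_fun setT g ->
  (forall w, `|f w| <= M) -> (forall w, `|g w| <= M) ->
  \int[P]_w f w - \int[P]_w g w = \int[P]_w (f w - g w).
Proof.
by move=> mf mg fM gM; rewrite RintegralB//; exact: bounded_integrable.
Qed.

Lemma expectation_dist f g M c : measurable_fun setT f -> measurable_fun setT g ->
  (forall w, `|f w| <= M) -> (forall w, `|g w| <= M) ->
  {ae P, forall w, `|f w - g w| <= c} -> `|\int[P]_w f w - \int[P]_w g w| <= c.
Proof.
move=> mf mg fM gM fg; rewrite (RexpectationB mf mg fM gM).
apply: (@norm_expectation_le _ (M + M)) => //; first exact: measurable_funB.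
by move=> w; apply: le_trans (ler_normB _ _) _; apply: lerD.
Qed.

Lemma expectation_cvg (f_ : nat -> Om -> R) f M :
  (forall n, measurable_fun setT (f_ n)) -> measurable_fun setT f ->
  (forall n w, `|f_ n w| <= M) -> {ae P, forall w, f_ n w @[n --> \oo] --> f w} ->
  \int[P]_w f_ n w @[n --> \oo] --> \int[P]_w f w.
Proof.
move=> mf_ mf fM ff.
have mE (g : Om -> R) : measurable_fun setT g -> measurable_fun setT (EFin \o g).
  by move=> mg; exact/measurable_EFinP.
have iM : P.-integrable setT (fun _ : Om => M%:E).
  by apply: (@bounded_integrable (fun=> M) `|M|).
have ffE : {ae P, forall w, setT w -> (EFin \o f_ n) w @[n --> \oo] --> (EFin \o f) w}.
  by apply: filterS ff => w h _; apply/fine_cvgP; split; first exact: nearW.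
have fME : {ae P, forall w, forall n, setT w -> (`|(EFin \o f_ n) w| <= M%:E)%E}.
  by apply: aeW => w n _; rewrite lee_fin.
have [fi _ h] := dominated_convergence measurableT (fun n => mE _ (mf_ n)) (mE _ mf) ffE iM fME.
apply: fine_cvg; rewrite fineK; last exact: integrable_fin_num.
exact: h.
Qed.

End expectation.

Lemma fubini_expectation d1 d2 (T1 : measurableType d1) (T2 : measurableType d2)
    (P1 : probability T1 R) (P2 : probability T2 R) (f : T1 * T2 -> R) (M : R) :
  measurable_fun setT f -> (forall z, `|f z| <= M) ->
  measurable_fun setT (fun x => \int[P2]_y f (x, y)) /\
  \int[(P1 \x P2)%E]_z f z = \int[P1]_x \int[P2]_y f (x, y).
Proof.
move=> mf fM.
have fi : (P1 \x P2)%E.-integrable setT (EFin \o f) by exact: bounded_integrable fM.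
have FE x : (\int[P2]_y f (x, y))%:E = fubini_F P2 (EFin \o f) x.
  rewrite fineK//; apply: integrable_fin_num => //.
  apply: (@bounded_integrable _ _ P2 (fun y => f (x, y)) M) => //.
  by apply: measurableT_comp => //; exact: measurable_pair1.
split.
  apply/measurable_EFinP; rewrite (_ : _ \o _ = fubini_F P2 (EFin \o f)); last exact/funext.
  exact: measurable_fubini_F fi.
rewrite /Rintegral -(integral12_prod_meas1 fi); congr fine.
by apply: eq_integral => x _; rewrite -FE.
Qed.

Lemma expectation_pushforward dO (Om : measurableType dO) (P : probability Om R)
    d' (T' : measurableType d') (U : {mfun Om >-> T'}) (f : T' -> R) (M : R) :
  measurable_fun setT f -> (forall z, `|f z| <= M) ->
  \int[distribution P U]_y f y = \int[P]_w f (U w).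
Proof.
move=> mf fM; congr fine; rewrite integral_distribution//; first exact/measurable_EFinP.
by apply: (@bounded_integrable _ _ P (f \o U) M) => [|w]; [exact: measurableT_comp|exact: fM].
Qed.

Lemma expectation_same_law d1 d2 (O1 : measurableType d1) (O2 : measurableType d2)
    (P1 : probability O1 R) (P2 : probability O2 R) d' (T' : measurableType d')
    (U1 : O1 -> T') (U2 : O2 -> T') (f : T' -> R) (M : R) :
  measurable_fun setT U1 -> measurable_fun setT U2 ->
  (forall A, measurable A -> P1 (U1 @^-1` A) = P2 (U2 @^-1` A)) ->
  measurable_fun setT f -> (forall z, `|f z| <= M) ->
  \int[P1]_w f (U1 w) = \int[P2]_w f (U2 w).
Proof.
move=> mU1 mU2 h mf fM.
pose V1 : {mfun O1 >-> T'} := HB.pack U1 (isMeasurableFun.Build _ _ _ _ U1 mU1).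
pose V2 : {mfun O2 >-> T'} := HB.pack U2 (isMeasurableFun.Build _ _ _ _ U2 mU2).
rewrite -(@expectation_pushforward _ _ P1 _ _ V1 f M)// -(@expectation_pushforward _ _ P2 _ _ V2 f M)//.
congr fine; apply: eq_measure_integral => A mA _.
exact: h.
Qed.

(** By uniqueness of product measures, independence on rectangles already identifies the law of
    [(U, V)] with the product of the two laws; Fubini does the rest. *)
Lemma expectation_indep dO (Om : measurableType dO) (P : probability Om R)
    d1 d2 (T1 : measurableType d1) (T2 : measurableType d2) (U : Om -> T1) (V : Om -> T2)
    (f : T1 * T2 -> R) (M : R) :
  measurable_fun setT U -> measurable_fun setT V ->
  (forall A B, measurable A -> measurable B ->
    P (U @^-1` A `&` V @^-1` B) = (P (U @^-1` A) * P (V @^-1` B))%E) ->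
  measurable_fun setT f -> (forall z, `|f z| <= M) ->
  \int[P]_w f (U w, V w) = \int[P]_w \int[P]_w' f (U w, V w').
Proof.
move=> mU mV UV mf fM.
pose U' : {mfun Om >-> T1} := HB.pack U (isMeasurableFun.Build _ _ _ _ U mU).
pose V' : {mfun Om >-> T2} := HB.pack V (isMeasurableFun.Build _ _ _ _ V mV).
have mUV : measurable_fun setT (fun w => (U w, V w)) by exact: measurable_fun_pair.
pose W : {mfun Om >-> (T1 * T2)%type} := HB.pack (fun w => (U w, V w)) (isMeasurableFun.Build _ _ _ _ _ mUV).
transitivity (\int[distribution P W]_z f z); first by rewrite (@expectation_pushforward _ _ _ _ _ _ _ M).
transitivity (\int[(distribution P U' \x distribution P V')%E]_z f z).
  congr fine; apply: eq_measure_integral => A mA _; apply/esym.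
  exact: product_measure_unique.
have [mF ->] := fubini_expectation (distribution P U') (distribution P V') mf fM.
have fx x : \int[distribution P V']_y f (x, y) = \int[P]_w' f (x, V w').
  rewrite (@expectation_pushforward _ _ _ _ _ _ (fun y => f (x, y)) M)//.
  by apply: measurableT_comp => //; exact: measurable_pair1.
rewrite (@expectation_pushforward _ _ _ _ _ _ (fun x => \int[distribution P V']_y f (x, y)) M)//.
  by apply: eq_Rintegral => w _; rewrite fx.
move=> x; apply: norm_expectation_le_bound => //.
by apply: measurableT_comp => //; exact: measurable_pair1.
Qed.

(** Bounded functions of this kind serve as test functions: they are stable under translation and
    under averaging over the noise, and they approximate indicators of open sets. *)
Definition lipschitz_fun d (L : R) (G : 'rV[R]_d -> R) := forall x y, `|G x - G y| <= L * `|x - y|.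

Lemma lipschitz_fun_continuous d (L : R) (G : 'rV[R]_d -> R) : lipschitz_fun L G -> continuous G.
Proof.
move=> lG x; apply/(@cvgrPdist_le _ _ _ (nbhs x) (nbhs_filter x)) => e e0.
have L1 : 0 < `|L| + 1 by rewrite ltr_wpDl.
near=> y; apply: le_trans (lG _ _) _.
apply: (@le_trans _ _ ((`|L| + 1) * `|x - y|)).
  by rewrite ler_wpM2r// (le_trans (ler_norm _))// lerDl.
rewrite -ler_pdivlMl// mulrC.
near: y; apply: cvgr_dist_le; first exact: cvg_id.
by rewrite divr_gt0.
Unshelve. all: by end_near. Qed.

Lemma lipschitz_borelV d (L : R) (G : 'rV[R]_d -> R) : lipschitz_fun L G -> measurable_fun setT (G : borel_rV R d -> R).
Proof. by move=> /lipschitz_fun_continuous; exact: continuous_borelV. Qed.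

Lemma BbP d (f : 'rV[R]_d -> R) : Bb f <-> Defs.bounded_fun f /\ measurable_fun setT (f : borel_rV R d -> R).
Proof.
split=> -[bf mf]; split => //; first by move=> _ B mB; rewrite setTI; exact: mf.
by move=> B mB; have := mf measurableT B mB; rewrite setTI.
Qed.

Lemma measurable_fun_rvecD d dO1 (O1 : measurableType dO1) dO2 (O2 : measurableType dO2)
    (V : O1 -> 'rV[R]_d) (U : O2 -> 'rV[R]_d) (f : 'rV[R]_d -> R) :
  measurable_fun setT (f : borel_rV R d -> R) -> rvec V -> rvec U ->
  measurable_fun setT (fun z : O1 * O2 => f (V z.1 + U z.2)).
Proof.
move=> mf rV rU; apply: (rvec_comp mf); apply: rvecD.
- by apply: (rvec_measurableT_comp rV); exact: measurable_fst.
- by apply: (rvec_measurableT_comp rU); exact: measurable_snd.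
Qed.

Lemma expectation_indepD dO (Om : measurableType dO) (P : probability Om R) d
    (U V : Om -> 'rV[R]_d) (f : 'rV[R]_d -> R) (M : R) : rvec U -> rvec V ->
  (forall A B, borelV d A -> borelV d B ->
    P (U @^-1` A `&` V @^-1` B) = (P (U @^-1` A) * P (V @^-1` B))%E) ->
  measurable_fun setT (f : borel_rV R d -> R) -> (forall z, `|f z| <= M) ->
  \int[P]_w f (U w + V w) = \int[P]_w \int[P]_w' f (U w + V w').
Proof.
move=> /rvec_measurable_fun mU /rvec_measurable_fun mV UV mf fM.
apply: (@expectation_indep _ _ P _ _ (borel_rV R d) (borel_rV R d) U V (fun z => f (z.1 + z.2)) M) => //.
apply: (@measurable_fun_rvecD _ _ (borel_rV R d) _ (borel_rV R d) id id) => //.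
Qed.

End random_vectors.

(** * Regularity and total variation *)

Section regularity.
Context {R : realType}.

Lemma Rexpectation_indic dO (Om : measurableType dO) (P : probability Om R) (A : set Om) :
  measurable A -> \int[P]_w \1_A w = fine (P A).
Proof. by move=> mA; rewrite /Rintegral integral_indic// setIT. Qed.

Lemma fine_probability_leU dO (Om : measurableType dO) (P : probability Om R) (A B C : set Om) :
  measurable A -> measurable B -> measurable C -> A `<=` B `|` C ->
  fine (P A) <= fine (P B) + fine (P C).
Proof.
move=> mA mB mC ABC; rewrite -lee_fin EFinD !fineK ?fin_num_measure//.
apply: le_trans (measureU2 P mB mC).
by apply: le_measure; rewrite ?inE//; exact: measurableU.
Qed.

Lemma fine_probability_le dO (Om : measurableType dO) (P : probability Om R) (A B : set Om) :
  measurable A -> measurable B -> A `<=` B -> fine (P A) <= fine (P B).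
Proof.
move=> mA mB AB; have := fine_probability_leU P mA mB measurable0.
by rewrite measure0 addr0; apply; rewrite setU0.
Qed.

Lemma cvge_exists_lt (u : nat -> \bar R) (l e : \bar R) :
  u n @[n --> \oo] --> l -> (l < e)%E -> exists n, (u n < e)%E.
Proof.
by move=> ul le; have [n _ h] := ul _ (open_ereal_lt' le); exists n; exact: h n (leqnn n).
Qed.

(** [F n] consists of the points at distance at least [1/(n+1)] from the complement of [A]. As [A]
    is open, the differences [A] minus [F n] decrease to the empty set, and continuity from above
    applies. *)
Lemma closed_regular d (mu : probability (borel_rV R d) R) (A : set 'rV[R]_d) : open A ->
  forall e : R, 0 < e -> exists F, [/\ closed F, F `<=` A & (mu (A `\` F) < e%:E)%E].
Proof.
move=> oA e e0.
pose F (n : nat) := [set x : 'rV[R]_d | forall y, ~ A y -> n.+1%:R^-1 <= `|x - y|].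
have cF n : closed (F n).
  have -> : F n = \bigcap_(y in ~` A) ((fun x => `|x - y|) @^-1` [set t | n.+1%:R^-1 <= t]).
    by apply/seteqP; split.
  apply: closed_bigI => y _; apply: closed_comp; last exact: closed_ge.
  move=> x _; apply: (@lipschitz_fun_continuous R d 1 (fun x => `|x - y|)) => u v.
  rewrite mul1r (_ : u - v = (u - y) - (v - y)); last by rewrite opprB addrA subrK.
  exact: ler_dist_dist.
have FA n : F n `<=` A.
  move=> x Fx; apply: contrapT => nAx; have := Fx x nAx.
  by rewrite subrr normr0 leNgt invr_gt0 ltr0n.
have mF n : borelV d (A `\` F n).
  apply: (@measurableD _ (borel_rV R d)); first exact: borelV_open.
  rewrite -(setCK (F n)); apply: (@measurableC _ (borel_rV R d)); apply: borelV_open.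
  exact: closed_openC.
have ni : nonincreasing_seq (fun n => A `\` F n).
  move=> m n mn; apply/subsetPset => x [Ax nF]; split => // Fm; apply: nF => y nAy.
  apply: le_trans (Fm y nAy); rewrite lef_pV2 ?posrE//.
  by rewrite ler_nat.
have cap0 : \bigcap_n (A `\` F n) = set0.
  apply/seteqP; split => // x Ax.
  have Axx : A x by have [] := Ax 0%N I.
  have /nbhs_ballP[r /= r0 rA] : nbhs x A by exact: open_nbhs_nbhs.
  have [k _ hk] := near_infty_natSinv_lt (PosNum r0).
  have [_] := Ax k I; apply=> y nAy; rewrite leNgt; apply/negP => yk; apply: nAy; apply: rA.
  rewrite -ball_normE /ball_/=; apply: lt_trans yk _; exact: (hk k (leqnn k)).
have h : mu (A `\` F n) @[n --> \oo] --> 0%E.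
  rewrite -(measure0 mu) -cap0.
  apply: (@nonincreasing_cvg_mu _ (borel_rV R d) R mu (fun n => A `\` F n)) => //.
    by apply: le_lt_trans (probability_le1 mu (mF 0%N)) _; rewrite ltry.
  by rewrite cap0; exact: (@measurable0 _ (borel_rV R d)).
have [|n hn] := cvge_exists_lt (e := e%:E) h; first by rewrite lte_fin.
by exists (F n); split.
Qed.

(** The sets that can be squeezed between a closed and an open set of almost equal measure form a
    sigma-algebra containing the open sets. Complements exchange the two sides; countable unions are
    the real work. *)
Lemma borelV_regular d (mu : probability (borel_rV R d) R) (B : set 'rV[R]_d) : borelV d B ->
  forall e : R, 0 < e -> exists F U, [/\ closed F, open U, F `<=` B, B `<=` U & (mu (U `\` F) < e%:E)%E].
Proof.
have mO (A : set 'rV[R]_d) : open A -> measurable (A : set (borel_rV R d)) by exact: borelV_open.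
have mC (A : set 'rV[R]_d) : closed A -> measurable (A : set (borel_rV R d)).
  by move=> cA; rewrite -(setCK A); apply: (@measurableC _ (borel_rV R d)); apply: mO; exact: closed_openC.
pose G := [set B : set 'rV[R]_d | forall e : R, 0 < e ->
  exists F U, [/\ closed F, open U, F `<=` B, B `<=` U & (mu (U `\` F) < e%:E)%E]].
apply: (@smallest_sub _ _ _ G); last first.
  move=> A oA e e0; have [F [cF FA h]] := closed_regular mu oA e0.
  by exists F, A; split.
split.
- move=> e e0; exists set0, set0; split; [exact: closed0|exact: open0|by []|by []|].
  by rewrite setD0 measure0 lte_fin.
- move=> A GA e e0; have [F [U [cF oU FA AU h]]] := GA e e0.
  exists (~` U), (~` F); split; [exact: open_closedC|exact: closed_openC| | |].
  + by move=> x nU; split => // /AU.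
  + by move=> x [_ nA] /FA.
  + by rewrite setDE setCK setIC -setDE.
- move=> A GA e e0.
  (* The errors [e / 2 / 2^(k+1)] add up to at most [e / 2]. The remaining margin is for truncation:
     an infinite union of closed sets need not be closed, so only the first [n] are kept, with [n]
     large by continuity from above. *)
  have ek k : 0 < e / 2 / (2 ^ k.+1)%:R by rewrite !divr_gt0// ltr0n expn_gt0.
  have /choice[F /choice[U hFU]] k : exists F U, [/\ closed F, open U, F `<=` A k, A k `<=` U & (mu (U `\` F) < (e / 2 / (2 ^ k.+1)%:R)%:E)%E].
    exact: GA (ek k).
  pose UU := \bigcup_k U k.
  have oUU : open UU by apply: bigcup_open => k _; have [] := hFU k.
  pose D n := UU `\` \bigcup_(k in `I_n) F k.
  have cF n : closed (\bigcup_(k in `I_n) F k).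
    by apply: closed_bigcup => // k _; have [] := hFU k.
  have mD n : measurable (D n : set (borel_rV R d)) by apply: (@measurableD _ (borel_rV R d)); [exact: mO|exact: mC].
  have mcap : measurable (\bigcap_n D n : set (borel_rV R d)) by exact: (@bigcapT_measurable _ (borel_rV R d)).
  have niD : nonincreasing_seq D.
    move=> m n mn; apply/subsetPset => x [Ux nF]; split => // -[k /= km Fk]; apply: nF.
    by exists k => //=; exact: leq_trans mn.
  have hD : mu (D n) @[n --> \oo] --> mu (\bigcap_n D n).
    apply: (@nonincreasing_cvg_mu _ (borel_rV R d) R mu D) => //.
    by apply: le_lt_trans (probability_le1 mu (mD 0%N)) _; rewrite ltry.
  have mudiff k : measurable (U k `\` F k : set (borel_rV R d)).
    by apply: (@measurableD _ (borel_rV R d)); [apply: mO|apply: mC]; have [] := hFU k.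
  have capD : (mu (\bigcap_n D n) <= (e / 2)%:E)%E.
    apply: (@le_trans _ _ (\sum_(0 <= k <oo) mu (U k `\` F k))%E).
      apply: (@measure_sigma_subadditive _ _ (borel_rV R d) mu) => // x Dx.
      have [[k _ Uk] _] := Dx 0%N I.
      exists k => //; split => // Fk; have [_] := Dx k.+1 I; apply; exists k => //=.
    apply: le_trans (epsilon_trick0 predT _); last by rewrite divr_ge0// ltW.
    apply: lee_nneseries => [k _ _ //|k _]; apply/ltW.
    by have [] := hFU k.
  have [|n hn] := cvge_exists_lt (e := e%:E) hD.
    apply: le_lt_trans capD _.
    by rewrite lte_fin ltr_pdivrMr// ltr_pMr// ltr1n.
  exists (\bigcup_(k in `I_n) F k), UU; split => //.
  + by move=> x [k _ Fk]; exists k => //; have [_ _ + _ _] := hFU k; exact.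
  + by move=> x [k _ Ak]; exists k => //; have [_ _ _ + _] := hFU k; exact.
Qed.

(** [G n x] is the infimum over [y] of [1_U(y) + n |x - y|], the largest [n]-Lipschitz minorant of
    the indicator. It equals 1 at [x] once [n r >= 1], for a ball of radius [r] around [x] inside
    [U]. *)
Lemma lipschitz_indic d (U : set 'rV[R]_d) : open U -> exists G : nat -> 'rV[R]_d -> R,
  [/\ forall n, lipschitz_fun n%:R (G n), forall n x, 0 <= G n x <= 1
    & forall x, G n x @[n --> \oo] --> (\1_U x : R)].
Proof.
move=> oU.
pose S n x := [set (\1_U y : R) + n%:R * `|x - y| | y in [set: 'rV[R]_d]].
have lb0 n x : lbound (S n x) 0 by move=> _ [y _ <-]; rewrite addr_ge0// mulr_ge0.
have ne n x : S n x !=set0 by exists (\1_U x + n%:R * `|x - x|); exists x.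
have lbS n x : has_lbound (S n x) by exists 0; exact: lb0.
have le1U n x : inf (S n x) <= \1_U x.
  by apply: ge_inf => //; exists x => //; rewrite subrr normr0 mulr0 addr0.
exists (fun n x => inf (S n x)); split.
- move=> n x y.
  suff H a b : inf (S n a) - inf (S n b) <= n%:R * `|a - b|.
    by rewrite ler_norml lerNl opprB H andbT distrC H.
  rewrite lerBlDr -lerBlDl; apply: lb_le_inf => // _ [z _ <-].
  rewrite lerBlDl; apply: le_trans (ge_inf (lbS n a) _) _; first by exists z.
  rewrite addrCA lerD2l -mulrDr ler_wpM2l//.
  by rewrite (_ : a - z = (a - b) + (b - z)) ?ler_normD// addrA subrK.
- move=> n x; rewrite lb_le_inf//=; apply: le_trans (le1U n x) _.
  by rewrite indicE; case: (_ \in _).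
- move=> x; have [Ux|nUx] := pselect (U x); last first.
    rewrite (_ : (fun n => inf (S n x)) = fun=> 0); first by rewrite indicE memNset//; exact: cvg_cst.
    apply/funext => n; apply/eqP; rewrite eq_le lb_le_inf// andbT.
    by apply: le_trans (le1U n x) _; rewrite indicE memNset.
  have /nbhs_ballP[r /= r0 rU] : nbhs x U by exact: open_nbhs_nbhs.
  have U1 : \1_U x = 1 :> R by rewrite indicE mem_set.
  rewrite U1; apply: cvg_near_cst.
  near=> n; apply/eqP; rewrite eq_le -{1}U1 le1U/=.
  apply: lb_le_inf => // _ [y _ <-].
  have [yr|ry] := ltP `|x - y| r.
    rewrite indicE mem_set; first by rewrite lerDl mulr_ge0.
    by apply: rU; rewrite -ball_normE.
  apply: (@le_trans _ _ (n%:R * r)); last first.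
    by rewrite -[leLHS]add0r lerD// ler_wpM2l.
  rewrite -ler_pdivrMr// div1r.
  near: n; exact: nbhs_infty_ger.
Unshelve. all: by end_near. Qed.

Section total_variation.
Context d {d1 d2 : measure_display} {O1 : measurableType d1} {O2 : measurableType d2}
  (P1 : probability O1 R) (P2 : probability O2 R)
  (V1 : O1 -> 'rV[R]_d) (V2 : O2 -> 'rV[R]_d) (K : R).
Hypotheses (rV1 : rvec V1) (rV2 : rvec V2)
  (lipK : forall (G : 'rV[R]_d -> R) (L : R), lipschitz_fun L G -> (forall x, 0 <= G x <= 1) ->
    `|\int[P1]_w G (V1 w) - \int[P2]_w G (V2 w)| <= K).

Let open_tv (U : set 'rV[R]_d) : open U ->
  `|fine (P1 (V1 @^-1` U)) - fine (P2 (V2 @^-1` U))| <= K.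
Proof.
move=> oU; have [G [lG G01 GU]] := lipschitz_indic oU.
have cv dO (Om : measurableType dO) (P : probability Om R) (V : Om -> 'rV[R]_d) : rvec V ->
    \int[P]_w G n (V w) @[n --> \oo] --> fine (P (V @^-1` U)).
  move=> rV; rewrite -Rexpectation_indic; last by apply: rV; exact: borelV_open.
  apply: (@expectation_cvg _ _ _ P (fun n w => G n (V w)) _ 1).
  - by move=> n; apply: (rvec_comp (lipschitz_borelV (lG n)) rV).
  - by apply: measurable_indic; apply: rV; exact: borelV_open.
  - by move=> n w; have /andP[h1 h2] := G01 n (V w); rewrite ger0_norm.
  - by apply: aeW => w; exact: GU.
have h : `|\int[P1]_w G n (V1 w) - \int[P2]_w G n (V2 w)| @[n --> \oo] --> `|fine (P1 (V1 @^-1` U)) - fine (P2 (V2 @^-1` U))|.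
  by apply: cvg_norm; apply: cvgB; exact: cv.
by apply: (cvgr_to_le h); apply: nearW => n; exact: lipK.
Qed.

(** The bound [K] does not involve the Lipschitz constant of the test function, so it survives the
    limit to indicators of open sets; outer regularity then carries it to Borel sets. *)
Lemma lipschitz_tv (B : set 'rV[R]_d) : borelV d B ->
  `|fine (P1 (V1 @^-1` B)) - fine (P2 (V2 @^-1` B))| <= K.
Proof.
move=> bB; apply/ler_addgt0Pr => e e0.
(* The estimate is kept for every smaller open neighbourhood of [B], because a single open set, the
   intersection of [U1] and [U2], has to serve both laws. *)
have outer dO (Om : measurableType dO) (P : probability Om R) (V : Om -> 'rV[R]_d) : rvec V ->
    exists U, [/\ open U, B `<=` U & forall U', open U' -> B `<=` U' -> U' `<=` U ->
      0 <= fine (P (V @^-1` U')) - fine (P (V @^-1` B)) <= e / 2].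
  move=> rV; have mV := (rvec_measurable_fun V).1 rV.
  pose V' : {mfun Om >-> borel_rV R d} := HB.pack V (isMeasurableFun.Build _ _ _ _ (V : Om -> borel_rV R d) mV).
  have [F [U [cF oU FB BU h]]] := borelV_regular (distribution P V') bB (divr_gt0 e0 (ltr0n _ 2)).
  exists U; split => // U' oU' BU' U'U.
  have mU' : measurable (V @^-1` U') by apply: rV; exact: borelV_open.
  have mB : measurable (V @^-1` B) by exact: rV.
  have mUF : measurable (V @^-1` (U `\` F)).
    apply: rV; apply: (@measurableD _ (borel_rV R d)); first exact: borelV_open.
    rewrite -(setCK F); apply: (@measurableC _ (borel_rV R d)); apply: borelV_open.
    exact: closed_openC.
  have UF : fine (P (V @^-1` (U `\` F))) <= e / 2.
    by rewrite -lee_fin fineK ?fin_num_measure//; exact: ltW.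
  rewrite subr_ge0 lerBlDl; apply/andP; split.
    by apply: fine_probability_le => // w; exact: BU'.
  apply: le_trans (lerD (lexx _) UF); apply: fine_probability_leU => // w Uw.
  have [Bw|nBw] := pselect (B (V w)); [by left|right].
  by split; [exact: U'U|move=> /FB].
have [U1 [oU1 B1 h1]] := outer _ _ P1 _ rV1.
have [U2 [oU2 B2 h2]] := outer _ _ P2 _ rV2.
have oU := openI oU1 oU2.
have BU : B `<=` U1 `&` U2 by move=> x Bx; split; [exact: B1|exact: B2].
move: (h1 _ oU BU (@subIsetl _ _ _)) (h2 _ oU BU (@subIsetr _ _ _)) (open_tv oU).
rewrite !ler_norml => /andP[? ?] /andP[? ?] /andP[? ?]; apply/andP; split; lra.
Qed.

End total_variation.
End regularity.

(** * Laws with the same characteristic function *)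

Section characteristic_function.
Context {R : realType}.

Lemma norm_cos_le1 (x : R) : `|cos x| <= 1.
Proof. by rewrite ler_norml; apply/andP; split; [exact: cos_geN1|exact: cos_le1]. Qed.

Lemma norm_sin_le1 (x : R) : `|sin x| <= 1.
Proof. by rewrite ler_norml; apply/andP; split; [exact: sin_geN1|exact: sin_le1]. Qed.

Lemma measurable_cos : measurable_fun setT (@cos R).
Proof. by apply: continuous_measurable_fun; exact: continuous_cos. Qed.

Lemma measurable_sin : measurable_fun setT (@sin R).
Proof. by apply: continuous_measurable_fun; exact: continuous_sin. Qed.

Lemma cos_dist_le (a b : R) : `|cos b - cos a| <= `|b - a|.
Proof.
wlog ab : a b / a < b.
  move=> H; have [|ba|->] := ltgtP a b; [exact: H| |by rewrite !subrr].
  by rewrite distrC (distrC b); exact: H.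
have [c _ ->] : exists2 c, c \in `]a, b[ & cos b - cos a = - sin c * (b - a).
  apply: MVT => //; apply: continuous_subspaceT; exact: continuous_cos.
by rewrite normrM normrN ler_piMl// norm_sin_le1.
Qed.

(** A quadratic bound is enough: it makes [m sin (x / m)] approach [x] with error at most
    [x^2 / m]. *)
Lemma sin_dist_id (t : R) : `|sin t - t| <= t ^+ 2.
Proof.
wlog t0 : t / 0 <= t.
  move=> H; have [|t0] := leP 0 t; first exact: H.
  by rewrite -[t]opprK sinN -opprD normrN sqrrN; apply: H; rewrite oppr_ge0 ltW.
move: t0; rewrite le_eqVlt => /predU1P[<-|t0]; first by rewrite sin0 subrr normr0 sqr_ge0.
have [c ct e] : exists2 c, c \in `]0, t[ & sin t - sin 0 = cos c * (t - 0).
  apply: MVT => //; apply: continuous_subspaceT; exact: continuous_sin.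
move: ct; rewrite in_itv/= => /andP[c0 ct].
have -> : sin t - t = (cos c - cos 0) * t by move: e; rewrite sin0 cos0 !subr0 => ->; ring.
rewrite normrM (gtr0_norm t0) expr2 ler_pM2r//.
by apply: le_trans (cos_dist_le _ _) _; rewrite subr0 gtr0_norm// ltW.
Qed.

Section dot.
Context {d : nat}.
Implicit Types u v x : 'rV[R]_d.

Lemma dotVDl u v x : dotV (u + v) x = dotV u x + dotV v x.
Proof. by rewrite /dotV -big_split; apply: eq_bigr => i _; rewrite mxE mulrDl. Qed.

Lemma dotVNl u x : dotV (- u) x = - dotV u x.
Proof. by rewrite /dotV -sumrN; apply: eq_bigr => i _; rewrite mxE mulNr. Qed.

Lemma dotVZl (a : R) u x : dotV (a *: u) x = a * dotV u x.
Proof. by rewrite /dotV mulr_sumr; apply: eq_bigr => i _; rewrite mxE mulrA. Qed.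

Lemma dotVC u v : dotV u v = dotV v u.
Proof. by apply: eq_bigr => i _; rewrite mulrC. Qed.

Lemma dotV0l x : dotV 0 x = 0.
Proof. by rewrite /dotV big1// => i _; rewrite mxE mul0r. Qed.

Lemma dotV_delta (i : 'I_d) x : dotV (delta_mx 0 i) x = x 0 i.
Proof.
rewrite /dotV (bigD1 i)//= mxE !eqxx mul1r big1 ?addr0// => j ji.
by rewrite mxE (negbTE ji) andbF mul0r.
Qed.

Lemma measurable_dotV u : measurable_fun setT (dotV u : borel_rV R d -> R).
Proof.
apply: measurable_sum => i; apply: measurable_funM => //.
by apply: (@continuous_borelV _ _ (fun x => x 0 i)); exact: coord_continuous.
Qed.

(** The phase [c] lets one constructor cover cosines, sines and constants, and the product-to-sum
    formula makes the class an algebra. *)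
Inductive trigpoly : ('rV[R]_d -> R) -> Prop :=
| trigpoly_cos a u c : trigpoly (fun x => a * cos (dotV u x + c))
| trigpoly_add f g : trigpoly f -> trigpoly g -> trigpoly (fun x => f x + g x).

Lemma eq_trigpoly f g : f =1 g -> trigpoly f -> trigpoly g.
Proof. by move=> /funext ->. Qed.

Lemma trigpoly_mul f g : trigpoly f -> trigpoly g -> trigpoly (fun x => f x * g x).
Proof.
elim=> [a u c|f1 f2 _ h1 _ h2] tg; last first.
  apply: (@eq_trigpoly (fun x => f1 x * g x + f2 x * g x)); first by move=> x; rewrite mulrDl.
  by apply: trigpoly_add; [exact: h1|exact: h2].
elim: tg => [b v e|g1 g2 _ h1 _ h2]; last first.
  apply: (@eq_trigpoly (fun x => a * cos (dotV u x + c) * g1 x + a * cos (dotV u x + c) * g2 x)).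
    by move=> x; rewrite mulrDr.
  exact: trigpoly_add.
apply: (@eq_trigpoly (fun x => (a * b / 2) * cos (dotV (u + v) x + (c + e)) +
   (a * b / 2) * cos (dotV (u - v) x + (c - e)))); last exact: trigpoly_add (trigpoly_cos _ _ _) (trigpoly_cos _ _ _).
move=> x; rewrite !dotVDl dotVNl.
rewrite (_ : dotV u x + dotV v x + (c + e) = (dotV u x + c) + (dotV v x + e)); last by ring.
rewrite (_ : dotV u x - dotV v x + (c - e) = (dotV u x + c) - (dotV v x + e)); last by ring.
by rewrite cosD cosB; field.
Qed.

Lemma trigpoly_cst a : trigpoly (fun=> a).
Proof.
by apply: eq_trigpoly (trigpoly_cos a 0 0) => x; rewrite dotV0l addr0 cos0 mulr1.
Qed.

Lemma trigpoly_bounded f : trigpoly f -> exists M, forall x, `|f x| <= M.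
Proof.
elim=> [a u c|f1 f2 _ [M1 h1] _ [M2 h2]].
  by exists `|a| => x; rewrite normrM ler_piMr// norm_cos_le1.
by exists (M1 + M2) => x; apply: le_trans (ler_normD _ _) _; exact: lerD.
Qed.

Lemma trigpoly_borelV f : trigpoly f -> measurable_fun setT (f : borel_rV R d -> R).
Proof.
elim=> [a u c|f1 f2 _ h1 _ h2]; last exact: measurable_funD.
apply: measurable_funM => //; apply: (measurableT_comp measurable_cos).
by apply: measurable_funD => //; exact: measurable_dotV.
Qed.

(** * Trigonometric approximation of Lipschitz functions by random walks *)

Section walk.
Variables (G : 'rV[R]_d -> R) (L delta : R).

(* The probability of moving in the direction +e_i is chosen so that the mean
   displacement of a step along the i-th axis is delta * sin (x_i / L). *)
Definition walk_prob (i : 'I_d) x : R := (1 + sin (x 0 i / L)) / 2.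

(** The mean of [G] at the end of a walk started at [y] whose successive axes are listed in [s]. The
    transition probabilities depend on the parameter [x] and not on the current position, so the
    mean is a trigonometric polynomial in [x], in the manner of Bernstein polynomials. *)
Fixpoint walk (s : seq 'I_d) (y x : 'rV[R]_d) : R :=
  if s is i :: s' then
    walk_prob i x * walk s' (y + delta *: delta_mx 0 i) x +
    (1 - walk_prob i x) * walk s' (y - delta *: delta_mx 0 i) x
  else G y.

Lemma walk_prob_itv i x : 0 <= walk_prob i x <= 1.
Proof.
have := sin_geN1 (x 0 i / L); have := sin_le1 (x 0 i / L); rewrite /walk_prob.
by move=> ? ?; apply/andP; split; lra.
Qed.

Lemma trigpoly_walk_prob i : trigpoly (walk_prob i).
Proof.
apply: (@eq_trigpoly (fun x => 2^-1 + 2^-1 * cos (dotV (L^-1 *: delta_mx 0 i) x + - (pi / 2)))).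
  move=> x; rewrite dotVZl dotV_delta cosB cos_pihalf sin_pihalf /walk_prob.
  by rewrite (mulrC L^-1); field.
exact: trigpoly_add (trigpoly_cst _) (trigpoly_cos _ _ _).
Qed.

Lemma trigpoly_walk s y : trigpoly (walk s y).
Proof.
elim: s y => [|i s IH] y; first exact: trigpoly_cst.
apply: trigpoly_add; apply: trigpoly_mul; try exact: IH; first exact: trigpoly_walk_prob.
apply: (@eq_trigpoly (fun x => 1 + (-1) * walk_prob i x)); first by move=> x; rewrite mulN1r.
apply: trigpoly_add; first exact: trigpoly_cst.
by apply: trigpoly_mul; [exact: trigpoly_cst|exact: trigpoly_walk_prob].
Qed.

Lemma walk_bounded (M : R) s y x : (forall z, `|G z| <= M) -> `|walk s y x| <= M.
Proof.
move=> GM; elim: s y => [|i s IH] y //=.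
have /andP[p0 p1] := walk_prob_itv i x; set p := walk_prob i x in p0 p1 *.
apply: le_trans (ler_normD _ _) _; rewrite normrM (ger0_norm p0) normrM (ger0_norm (_ : 0 <= 1 - p)) ?subr_ge0//.
have h1 := ler_wpM2l p0 (IH (y + delta *: delta_mx 0 i)).
have h2 := ler_wpM2l (_ : 0 <= 1 - p) (IH (y - delta *: delta_mx 0 i)).
by apply: le_trans (lerD h1 (h2 _)) _; [rewrite subr_ge0|rewrite -mulrDl addrCA subrr addr0 mul1r].
Qed.

(** In each coordinate the mean-square distance from the end of the walk to [z] is at most squared
    bias plus variance, a step having variance at most [delta^2]. Bounding [|a|] by
    [(e + a^2 / e) / 2] lets the induction deal with a quadratic quantity instead of a norm. *)
Lemma walk_error (K e : R) s y x z : 0 <= K -> lipschitz_fun K G -> 0 < e ->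
  `|walk s y x - G z| <= K * \sum_i ((e + ((y 0 i + (count_mem i s)%:R * delta * sin (x 0 i / L) - z 0 i) ^+ 2
     + (count_mem i s)%:R * delta ^+ 2) / e) / 2).
Proof.
move=> K0 lG e0; elim: s y => [|i s IH] y /=.
  apply: le_trans (lG _ _) _; rewrite ler_wpM2l//; apply: le_trans (rV_norm_le_sum _) _.
  apply: ler_sum => i _; rewrite !mxE !mul0r !addr0; set a := y 0 i - z 0 i.
  rewrite ler_pdivlMr// -(ler_pM2r e0) [leRHS]mulrDl mulfVK ?gt_eqF//.
  have : 0 <= (`|a| - e) ^+ 2 by exact: sqr_ge0.
  by rewrite -(real_normK (num_real a)) ; nra.
have /andP[p0 p1] := walk_prob_itv i x; set p := walk_prob i x in p0 p1 *.
have q0 : 0 <= 1 - p by rewrite subr_ge0.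
set A := walk s (y + _) x; set B := walk s (y - _) x.
have -> : p * A + (1 - p) * B - G z = p * (A - G z) + (1 - p) * (B - G z) by ring.
apply: le_trans (ler_normD _ _) _; rewrite normrM (ger0_norm p0) normrM (ger0_norm q0).
apply: le_trans (lerD (ler_wpM2l p0 (IH _)) (ler_wpM2l q0 (IH _))) _.
rewrite !(mulrCA _ K) -mulrDr ler_wpM2l// !mulr_sumr -big_split/=.
apply: ler_sum => j _; rewrite !mxE !eqxx/=.
have e2 : 0 < e^-1 by rewrite invr_gt0.
have [->|ji] := eqVneq j i; rewrite /= ?mulr0 ?subr0 ?addr0 ?add0n ?add1n; last first.
  by rewrite -mulrDl addrC subrK mul1r.
rewrite mulr1 -natr1; set n := (count_mem i s)%:R; set sn := sin _; set t := y 0 i; set c := z 0 i.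
have pE : p = (1 + sn) / 2 by [].
have sn2 : 0 <= sn ^+ 2 by exact: sqr_ge0.
have : 0 <= (delta * sn) ^+ 2 * e^-1 by rewrite mulr_ge0 ?sqr_ge0// ltW.
rewrite pE => ds.
(* A step has mean [delta sn] and variance [delta^2 - (delta sn)^2]; the slack comes from the
   subtracted square, which the bound drops. *)
rewrite -subr_ge0 (_ : _ - _ = (delta * sn) ^+ 2 * e^-1 / 2); first by rewrite divr_ge0.
by field; rewrite gt_eqF.
Qed.

End walk.

Definition walk_axes (N : nat) : seq 'I_d := flatten [seq nseq N i | i <- enum 'I_d].

Lemma count_walk_axes N i : count_mem i (walk_axes N) = N.
Proof.
rewrite /walk_axes count_flatten -map_comp sumnE big_map big_enum/= (bigD1 i)//=.
rewrite count_nseq/= eqxx mul1n big1 ?addn0// => j ji.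
by rewrite count_nseq/= (negbTE ji).
Qed.

(** With [m = n+1], the scale in the sine is [m], the step is [m^-3] and each axis gets [m^4] steps.
    The mean displacement is then [m sin (x_i / m)], which tends to [x_i], while the variance is at
    most [m^-2]. With [e = 1/m] the total error is at most [|K| / m] times the sum of the
    [1 + x_i^4]. *)
Lemma walk_cvg (G : 'rV[R]_d -> R) (K : R) x : lipschitz_fun K G ->
  walk G n.+1%:R (n.+1%:R ^- 3) (walk_axes (n.+1 ^ 4)%N) 0 x @[n --> \oo] --> G x.
Proof.
move=> lG.
have K0 : 0 <= `|K| by [].
have lG' : lipschitz_fun `|K| G.
  by move=> u v; apply: le_trans (lG u v) _; rewrite ler_wpM2r// ler_norm.
apply/cvgrPdist_le => e e0.
pose C := `|K| * \sum_i (1 + x 0 i ^+ 4).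
have C0 : 0 <= C by rewrite mulr_ge0// sumr_ge0// => i _; rewrite addr_ge0// exprn_even_ge0.
have C1 : 0 < C + 1 by rewrite ltr_wpDl.
near=> n; rewrite distrC.
have n0 : 0 < n.+1%:R^-1 :> R by rewrite invr_gt0.
apply: le_trans (walk_error _ _ _ _ _ _ K0 lG' n0) _.
apply: (@le_trans _ _ (C * n.+1%:R^-1)); last first.
  apply: (@le_trans _ _ ((C + 1) * n.+1%:R^-1)); first by apply: ler_wpM2r; [exact: ltW|rewrite lerDl].
  rewrite -ler_pdivlMl// mulrC; apply/ltW.
  near: n; exact: (near_infty_natSinv_lt (PosNum (divr_gt0 e0 C1))).
rewrite /C -mulrA ler_wpM2l// mulr_suml; apply: ler_sum => i _.
rewrite count_walk_axes mxE add0r natrX.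
set m : R := n.+1%:R; have m0 : m != 0 by rewrite pnatr_eq0.
have m1 : 0 < m by rewrite ltr0n.
have -> : m ^+ 4 * m ^- 3 = m by field.
have -> : m ^+ 4 * (m ^- 3) ^+ 2 = m ^- 2 by field.
rewrite invrK.
have h : (m * sin (x 0 i / m) - x 0 i) ^+ 2 <= x 0 i ^+ 4 * m ^- 2.
  have -> : m * sin (x 0 i / m) - x 0 i = m * (sin (x 0 i / m) - x 0 i / m) by field.
  rewrite exprMn; have := sin_dist_id (x 0 i / m); set a := sin _ - _ => ha.
  apply: (@le_trans _ _ (m ^+ 2 * ((x 0 i / m) ^+ 2) ^+ 2)).
    rewrite ler_wpM2l ?sqr_ge0// -[a ^+ 2]real_normK ?num_real// lerXn2r// nnegrE ?sqr_ge0//.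
  by rewrite le_eqVlt; apply/orP; left; apply/eqP; field.
apply: (@le_trans _ _ ((m^-1 + (x 0 i ^+ 4 * m ^- 2 + m ^- 2) * m) / 2)).
  by rewrite ler_pM2r ?invr_gt0// lerD2l ler_pM2r// lerD2r.
rewrite (_ : (x 0 i ^+ 4 * m ^- 2 + m ^- 2) * m = (x 0 i ^+ 4 + 1) * m^-1); last by field.
have : 0 <= x 0 i ^+ 4 * m^-1 by rewrite mulr_ge0 ?exprn_even_ge0// invr_ge0 ltW.
by rewrite !mulrDl !mul1r; move: (m^-1) => r; lra.
Unshelve. all: by end_near. Qed.

End dot.

(** * Characteristic functions determine expectations of bounded Lipschitz functions *)

Section cf_uniqueness.
Context {d : nat} {d1 d2 : measure_display} {O1 : measurableType d1} {O2 : measurableType d2}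
  (P1 : probability O1 R) (P2 : probability O2 R)
  (V1 : O1 -> 'rV[R]_d) (V2 : O2 -> 'rV[R]_d).
Hypotheses (rV1 : rvec V1) (rV2 : rvec V2)
  (cf : forall u c, \int[P1]_w cos (dotV u (V1 w) + c) = \int[P2]_w cos (dotV u (V2 w) + c)).

Let trigpoly_expectation (f : 'rV[R]_d -> R) : trigpoly f ->
  \int[P1]_w f (V1 w) = \int[P2]_w f (V2 w).
Proof.
have itg dO (Om : measurableType dO) (P : probability Om R) (V : Om -> 'rV[R]_d) (g : 'rV[R]_d -> R) :
    rvec V -> trigpoly g -> P.-integrable setT (EFin \o (fun w => g (V w))).
  move=> rV tg; have [M gM] := trigpoly_bounded tg.
  by apply: (@bounded_integrable _ _ _ P (fun w => g (V w)) M) => //; apply: rvec_comp => //; exact: trigpoly_borelV.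
elim=> [a u c|f1 f2 tf hf tg hg].
  have ti : trigpoly (fun x : 'rV[R]_d => cos (dotV u x + c)).
    by apply: eq_trigpoly (trigpoly_cos 1 u c) => x; rewrite mul1r.
  by rewrite !RintegralZl//= ?cf//; [exact: (itg _ _ P2 _ _ rV2 ti)|exact: (itg _ _ P1 _ _ rV1 ti)].
by rewrite !RintegralD ?hf ?hg//; apply: itg.
Qed.

(** The walk polynomials are bounded by [M] for all [n] and converge pointwise, so dominated
    convergence suffices, without uniform approximation or tightness. The free phase in [cf] encodes
    the real and imaginary parts together. *)
Lemma cf_unique (G : 'rV[R]_d -> R) (K M : R) : lipschitz_fun K G -> (forall x, `|G x| <= M) ->
  \int[P1]_w G (V1 w) = \int[P2]_w G (V2 w).
Proof.
move=> lG GM.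
pose f n := walk G n.+1%:R (n.+1%:R ^- 3) (walk_axes (n.+1 ^ 4)%N) 0.
have cv dO (Om : measurableType dO) (P : probability Om R) (V : Om -> 'rV[R]_d) : rvec V ->
    \int[P]_w f n (V w) @[n --> \oo] --> \int[P]_w G (V w).
  move=> rV; apply: (@expectation_cvg _ _ _ P (fun n w => f n (V w)) _ M).
  - by move=> n; apply: rvec_comp => //; apply: trigpoly_borelV; exact: trigpoly_walk.
  - exact: (rvec_comp (lipschitz_borelV lG)).
  - by move=> n w; exact: walk_bounded.
  - by apply: aeW => w; exact: walk_cvg lG.
have h1 := cv _ _ P1 _ rV1; have h2 := cv _ _ P2 _ rV2.
have E : (fun n => \int[P1]_w f n (V1 w)) = (fun n => \int[P2]_w f n (V2 w)).
  by apply/funext => n; rewrite trigpoly_expectation//; exact: trigpoly_walk.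
by rewrite E in h1; exact: (cvg_unique _ h1 h2).
Qed.

End cf_uniqueness.
End characteristic_function.

(** * One-dimensional normal laws *)

Section normal_law.
Context {R : realType}.
Local Notation mu := (@lebesgue_measure R).

Lemma integral_normal_prob (m s : R) (f : R -> R) (M : R) :
  measurable_fun setT f -> (forall x, `|f x| <= M) ->
  \int[normal_prob m s]_x f x = \int[mu]_x (f x * normal_pdf m s x).
Proof.
move=> mf fM; congr fine.
have fi : (normal_prob m s).-integrable setT (EFin \o f) by apply: (@bounded_integrable _ _ _ (normal_prob m s) f M).
have dom := normal_prob_dominates m s.
under [RHS]eq_integral do rewrite EFinM.
rewrite -(Radon_Nikodym_change_of_variables dom)//=.
have mp : measurable_fun setT (EFin \o normal_pdf m s).
  by apply/measurable_EFinP; exact: measurable_normal_pdf.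
apply: ae_eq_integral => //.
- apply: emeasurable_funM; first exact/measurable_EFinP.
  by apply: (measurable_int mu); exact: Radon_Nikodym_integrable.
- by apply: emeasurable_funM => //; exact/measurable_EFinP.
- apply: ae_eqe_mul2l => /=.
  rewrite Radon_NikodymE//=.
  case: cid => /= h [h1 h2 h3].
  apply: integral_ae_eq => //=.
  by move=> E E01 mE; rewrite -h3.
Qed.

Lemma normal_fun_scale (m s x : R) : 0 < s ->
  normal_fun m s x = expR (- ((x - m) / s) ^+ 2 / 2).
Proof. by move=> s0; rewrite /normal_fun; congr expR; field; rewrite gt_eqF. Qed.

Lemma normal_peak_double (s : R) : 0 < s -> normal_peak s = 2 * normal_peak (2 * s).
Proof.
move=> s0; rewrite /normal_peak (_ : (2 * s) ^+ 2 * pi *+ 2 = 2 ^+ 2 * (s ^+ 2 * pi *+ 2)); last by ring.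
rewrite sqrtrM ?sqr_ge0// (sqrtr_sqr 2) ger0_norm//.
by rewrite invfM mulrA divff ?mul1r.
Qed.

(** With [t = (x - m) / s] the claim reads [|t| <= 2 exp (3 t^2 / 8)], a consequence of
    [1 + y <= exp y]. Doubling the deviation absorbs [|x - m|] into another normal density, whose
    integral is known, so no moments have to be computed. *)
Lemma normal_pdf_dom1 (m s x : R) : 0 < s ->
  `|x - m| * normal_pdf m s x <= 4 * s * normal_pdf m (2 * s) x.
Proof.
move=> s0; have s20 : 0 < 2 * s by rewrite mulr_gt0.
rewrite !normal_pdfE ?gt_eqF// normal_peak_double// !normal_fun_scale//.
set t := (x - m) / s.
have -> : (x - m) / (2 * s) = t / 2 by rewrite /t; field; rewrite gt_eqF.
have -> : `|x - m| = s * `|t| by rewrite /t normrM normfV (gtr0_norm s0) mulrCA divff ?mulr1// gt_eqF.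
set k := normal_peak _; have k0 : 0 <= k by exact: normal_peak_ge0.
have -> : s * `|t| * (2 * k * expR (- t ^+ 2 / 2)) = (2 * s * k) * (`|t| * expR (- t ^+ 2 / 2)) by ring.
have -> : 4 * s * (k * expR (- (t / 2) ^+ 2 / 2)) = (2 * s * k) * (2 * expR (- (t / 2) ^+ 2 / 2)) by ring.
apply: ler_wpM2l; first by rewrite !mulr_ge0// ltW.
have -> : - (t / 2) ^+ 2 / 2 = - t ^+ 2 / 2 + 3 / 8 * t ^+ 2 by field.
rewrite expRD mulrCA (mulrC `|t|); apply: ler_wpM2l; first exact: expR_ge0.
have h := expR_ge1Dx (3 / 8 * t ^+ 2).
apply: (@le_trans _ _ (2 * (1 + 3 / 8 * t ^+ 2))); last by rewrite ler_pM2l.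
rewrite -(real_normK (num_real t)); move: `|t| => r.
have : 0 <= (r - 1) ^+ 2 by exact: sqr_ge0.
have : 0 <= r ^+ 2 by exact: sqr_ge0.
by nra.
Qed.

Lemma integrable_pdfM (m s : R) (f : R -> R) : 0 < s -> measurable_fun setT f ->
  (exists a b : R, forall x, `|f x| <= a + b * `|x - m|) ->
  mu.-integrable setT (EFin \o (fun x => f x * normal_pdf m s x)).
Proof.
move=> s0 mf [a [b fab]].
have i1 : mu.-integrable setT (EFin \o (fun x => `|a| * normal_pdf m s x)).
  by apply: (@integrableZl _ _ _ mu setT measurableT `|a| (EFin \o normal_pdf m s)); exact: integrable_normal_pdf.
have i2 : mu.-integrable setT (EFin \o (fun x => `|b| * (4 * s) * normal_pdf m (2 * s) x)).
  by apply: (@integrableZl _ _ _ mu setT measurableT (`|b| * (4 * s)) (EFin \o normal_pdf m (2 * s))); exact: integrable_normal_pdf.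
apply: (le_integrable _ _ _ (integrableD _ i1 i2)) => //.
  by apply/measurable_EFinP; apply: measurable_funM => //; exact: measurable_normal_pdf.
move=> x _ /=; rewrite lee_fin normrM (ger0_norm (normal_pdf_ge0 _ _ _)).
apply: le_trans (ler_norm _).
apply: (@le_trans _ _ ((`|a| + `|b| * `|x - m|) * normal_pdf m s x)).
  rewrite ler_wpM2r ?normal_pdf_ge0//; apply: le_trans (fab x) _.
  by rewrite lerD ?ler_norm// ler_wpM2r// ler_norm.
rewrite mulrDl lerD2l -!mulrA ler_wpM2l// mulrA.
exact: normal_pdf_dom1.
Qed.

(** The sum of the two exponentials stands for their maximum, the bound of the mean value theorem; a
    sum of densities can be integrated term by term. *)
Lemma expR_dist (a b : R) : `|expR a - expR b| <= `|a - b| * (expR a + expR b).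
Proof.
suff H (x y : R) : expR x - expR y <= `|x - y| * (expR x + expR y).
  by rewrite ler_norml H andbT lerNl opprB (distrC a) (addrC (expR a)) H.
have -> : expR y = expR x * expR (y - x) by rewrite -expRD addrC subrK.
have h := expR_ge1Dx (y - x); have ey := expR_ge0 (y - x); have ex := expR_ge0 x.
apply: (@le_trans _ _ (expR x * `|x - y|)).
  have -> : expR x - expR x * expR (y - x) = expR x * (1 - expR (y - x)) by ring.
  by apply: ler_wpM2l => //; apply: le_trans (ler_norm _); lra.
by rewrite mulrC ler_wpM2l// lerDl mulr_ge0.
Qed.

(** The exponents differ by [m (2x - m) / (2 s^2)]. In front of each density, [2x - m] is recentred
    at the mean of that density, so that [normal_pdf_dom1] applies to both. *)
Lemma normal_pdf_dist (m s x : R) : 0 < s ->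
  `|normal_pdf m s x - normal_pdf 0 s x| <= `|m| / (2 * s ^+ 2) *
    ((8 * s * normal_pdf m (2 * s) x + `|m| * normal_pdf m s x) +
     (8 * s * normal_pdf 0 (2 * s) x + `|m| * normal_pdf 0 s x)).
Proof.
move=> s0; have s1 : s != 0 by rewrite gt_eqF.
have h : `|normal_pdf m s x - normal_pdf 0 s x| <=
    `|m| / (2 * s ^+ 2) * (`|x + (x - m)| * normal_pdf m s x + `|x + (x - m)| * normal_pdf 0 s x).
  rewrite !normal_pdfE// -mulrBr normrM (ger0_norm (normal_peak_ge0 _)) /normal_fun.
  set a := - (x - m) ^+ 2 / _; set b := - (x - 0) ^+ 2 / _.
  apply: le_trans (ler_wpM2l (normal_peak_ge0 _) (expR_dist a b)) _.
  have -> : a - b = m / (2 * s ^+ 2) * (x + (x - m)) by rewrite /a /b; field.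
  rewrite normrM normrM normfV (ger0_norm (_ : 0 <= 2 * s ^+ 2)); last by rewrite mulr_ge0// sqr_ge0.
  by rewrite le_eqVlt; apply/orP; left; apply/eqP; ring.
apply: le_trans h _; rewrite ler_wpM2l ?divr_ge0// ?mulr_ge0 ?sqr_ge0 ?(ltW s0)//.
have m1 := normal_pdf_dom1 m x s0; have m2 := normal_pdf_dom1 0 x s0.
have p1 := normal_pdf_ge0 m s x; have p2 := normal_pdf_ge0 0 s x.
rewrite subr0 in m2.
apply: lerD.
  apply: (@le_trans _ _ ((2 * `|x - m| + `|m|) * normal_pdf m s x)); last by nra.
  rewrite ler_wpM2r// (_ : x + (x - m) = 2 * (x - m) + m); last by ring.
  by apply: le_trans (ler_normD _ _) _; rewrite normrM ger0_norm.
apply: (@le_trans _ _ ((2 * `|x| + `|m|) * normal_pdf 0 s x)); last by nra.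
rewrite ler_wpM2r// (_ : x + (x - m) = 2 * x - m); last by ring.
by apply: le_trans (ler_normB _ _) _; rewrite normrM ger0_norm.
Qed.

Lemma Rintegral_normal_pdf (m s c : R) : \int[mu]_x (c * normal_pdf m s x) = c.
Proof.
rewrite RintegralZl//; last exact: integrable_normal_pdf.
by rewrite /Rintegral integral_normal_pdf mulr1.
Qed.

Lemma integrable_normal_pdfZ (m s c : R) : mu.-integrable setT (EFin \o (fun x => c * normal_pdf m s x)).
Proof.
by apply: (@integrableZl _ _ _ mu setT measurableT c (EFin \o normal_pdf m s)); exact: integrable_normal_pdf.
Qed.

(** Integrating [normal_pdf_dist] gives [(|m| / s) (8 + |m| / s)], at most [9 |m| / s] when
    [|m| < s]. Otherwise the left side is at most 2 and the right side at least 9. *)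
Lemma normal_tv (m s : R) (G : R -> R) : 0 < s -> measurable_fun setT G ->
  (forall x, `|G x| <= 1) ->
  `|\int[normal_prob m s]_x G x - \int[normal_prob 0 s]_x G x| <= 9 * (`|m| / s).
Proof.
move=> s0 mG G1.
have [sm|ms] := leP s `|m|.
  have h1 (k : R) : `|\int[normal_prob k s]_x G x| <= 1 by exact: norm_expectation_le_bound.
  apply: le_trans (ler_normB _ _) _; apply: le_trans (lerD (h1 m) (h1 0)) _.
  have : 1 <= `|m| / s by rewrite ler_pdivlMr// mul1r.
  by move: (`|m| / s) => r; lra.
rewrite !(integral_normal_prob _ _ mG G1).
have iG k : mu.-integrable setT (EFin \o (fun x => G x * normal_pdf k s x)).
  by apply: integrable_pdfM => //; exists 1, 0 => x; rewrite mul0r addr0.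
rewrite -RintegralB//.
have iB : mu.-integrable setT (EFin \o (fun x => G x * normal_pdf m s x - G x * normal_pdf 0 s x)).
  by apply: (integrableB measurableT (iG m) (iG 0)).
apply: le_trans (le_normr_Rintegral _ iB) _ => //.
pose B x := (8 * s * normal_pdf m (2 * s) x + `|m| * normal_pdf m s x) +
     (8 * s * normal_pdf 0 (2 * s) x + `|m| * normal_pdf 0 s x).
have iD (f g : R -> R) : mu.-integrable setT (EFin \o f) -> mu.-integrable setT (EFin \o g) ->
    mu.-integrable setT (EFin \o (fun x => f x + g x)).
  by move=> f1 g1; exact: (integrableD measurableT f1 g1).
have i1 k : mu.-integrable setT (EFin \o (fun x => 8 * s * normal_pdf k (2 * s) x + `|m| * normal_pdf k s x)).
  by apply: iD; exact: integrable_normal_pdfZ.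
have iBB : mu.-integrable setT (EFin \o B) by exact: iD.
apply: (@le_trans _ _ (\int[mu]_x (`|m| / (2 * s ^+ 2) * B x))).
  apply: le_Rintegral => //.
  - exact: (integrable_norm iB).
  - exact: (@integrableZl _ _ _ mu setT measurableT (`|m| / (2 * s ^+ 2)) _ iBB).
  - move=> x _; rewrite -mulrBr normrM; apply: le_trans (normal_pdf_dist m x s0).
    by rewrite ler_piMl.
rewrite RintegralZl// /B RintegralD// !RintegralD ?Rintegral_normal_pdf//; try exact: integrable_normal_pdfZ.
have s1 : s != 0 by rewrite gt_eqF.
have -> : `|m| / (2 * s ^+ 2) * (8 * s + `|m| + (8 * s + `|m|)) = `|m| / s * (8 + `|m| / s) by field.
rewrite [leLHS]mulrC; apply: ler_wpM2r; first by rewrite divr_ge0// ltW.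
have : `|m| / s <= 1 by rewrite ler_pdivrMr// mul1r ltW.
by move: (`|m| / s) => r; lra.
Qed.


(** * Characteristic function of the normal law, by a differential equation *)

Section normal_cf.
Variables (m s c : R).
Hypothesis s0 : 0 < s.

Let p := normal_pdf m s.
Let th (u x : R) := u * (x - m) + c.
Let A (u : R) := \int[mu]_x (cos (th u x) * p x).
(** The derivative in [x] of [- sin (th u x) p x]; that its integral vanishes is the integration by
    parts of the argument. *)
Let g (u x : R) := (x - m) / s ^+ 2 * (sin (th u x) * p x) - u * (cos (th u x) * p x).

Let mth u : measurable_fun setT (th u).
Proof. by apply: measurable_funD => //; apply: measurable_funM => //; exact: measurable_funB. Qed.

Let mcos u : measurable_fun setT (fun x => cos (th u x)).
Proof. exact: (measurableT_comp (@measurable_cos R)). Qed.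

Let msin u : measurable_fun setT (fun x => sin (th u x)).
Proof. exact: (measurableT_comp (@measurable_sin R)). Qed.

Let icos u : mu.-integrable setT (EFin \o (fun x => cos (th u x) * p x)).
Proof. by apply: integrable_pdfM => //; exists 1, 0 => x; rewrite mul0r addr0 norm_cos_le1. Qed.

Let ixsin u : mu.-integrable setT (EFin \o (fun x => (x - m) * sin (th u x) * p x)).
Proof.
apply: integrable_pdfM => //; first by apply: measurable_funM => //; exact: measurable_funB.
by exists 0, 1 => x; rewrite add0r mul1r normrM ler_piMr// norm_sin_le1.
Qed.

Let derive_pdf (x : R) : is_derive x (1 : R) p (- ((x - m) / s ^+ 2) * p x).
Proof.
have -> : p = fun x => normal_peak s * expR (- (x - m) ^+ 2 / (s ^+ 2 *+ 2)).
  by apply/funext => y; rewrite /p normal_pdfE ?gt_eqF.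
apply: is_derive_eq.
rewrite /GRing.scale/=.
have s1 : s != 0 by rewrite gt_eqF.
by field.
Qed.

Let derive_F (u x : R) : is_derive x (1 : R) (fun x => - sin (th u x) * p x) (g u x).
Proof.
have := derive_pdf x => dp.
rewrite /g /th; apply: is_derive_eq.
rewrite /GRing.scale/=.
have s1 : s != 0 by rewrite gt_eqF.
by field.
Qed.

Let derive_th (u x : R) : is_derive u (1 : R) (fun u => cos (th u x) * p x) (- (x - m) * sin (th u x) * p x).
Proof.
rewrite /th; apply: is_derive_eq.
rewrite /GRing.scale/=.
by ring.
Qed.

Let derive_A (u : R) : is_derive u (1 : R) A (- \int[mu]_x ((x - m) * sin (th u x) * p x)).
Proof.
pose f (v x : R) := cos (th v x) * p x.
have d1 v x : partial1of2 f v x = - (x - m) * sin (th v x) * p x.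
  by rewrite partial1of2E; exact: (@derive_val _ _ _ _ _ _ _ (derive_th v x)).
have Iu : `]u - 1, u + 1[%classic u by rewrite /= in_itv/= ltrDl ltrBlDr ltrDl ltr01.
have fi v : `]u - 1, u + 1[%classic v -> mu.-integrable setT (EFin \o f v) by move=> _; exact: icos.
have df v x : `]u - 1, u + 1[%classic v -> setT x -> derivable (f^~ x) v 1.
  by move=> _ _; exact: (@ex_derive _ _ _ _ _ _ _ (derive_th v x)).
pose G x := `|x - m| * p x.
have G0 x : 0 <= G x by rewrite mulr_ge0// normal_pdf_ge0.
have iG : mu.-integrable setT (EFin \o G).
  apply: integrable_pdfM => //; first by apply: measurableT_comp => //; exact: measurable_funB.
  by exists 0, 1 => x; rewrite normr_id add0r mul1r.
have fG v x : `]u - 1, u + 1[%classic v -> setT x -> `|partial1of2 f v x| <= G x.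
  move=> _ _; rewrite d1 normrM (ger0_norm (normal_pdf_ge0 _ _ _)) ler_wpM2r ?normal_pdf_ge0//.
  by rewrite normrM normrN ler_piMr// norm_sin_le1.
have D := derivable_under_integral measurableT Iu fi df G0 iG fG.
apply: DeriveDef => //; rewrite -derive1E.
have -> := differentiation_under_integral measurableT Iu fi df G0 iG fG.
rewrite -mulN1r -RintegralZl//; apply: eq_Rintegral => x _.
by rewrite d1; ring.
Qed.

(** Fundamental theorem of calculus on [[m - (n+1), m + (n+1)]]; the boundary terms decay at least
    like [(n+1)^-2]. *)
Let int_g u : \int[mu]_x g u x = 0.
Proof.
have s1 : s != 0 by rewrite gt_eqF.
have ig : mu.-integrable setT (EFin \o g u).
  rewrite (_ : g u = fun x => ((x - m) / s ^+ 2 * sin (th u x) - u * cos (th u x)) * p x); last first.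
    by apply/funext => x; rewrite /g; ring.
  apply: integrable_pdfM => //.
    apply: measurable_funB; apply: measurable_funM => //.
    by apply: measurable_funM => //; exact: measurable_funB.
  exists `|u|, (s ^+ 2)^-1 => x; apply: le_trans (ler_normB _ _) _; rewrite addrC; apply: lerD.
    by rewrite normrM ler_piMr// norm_cos_le1.
  rewrite normrM; apply: le_trans (ler_piMr _ (norm_sin_le1 _)) _ => //.
  by rewrite normrM normfV (ger0_norm (sqr_ge0 s)) mulrC.
pose I (n : nat) : set R := `[m - n.+1%:R, m + n.+1%:R]%classic.
pose F x := - sin (th u x) * p x.
have lt_I (n : nat) : m - n.+1%:R < m + n.+1%:R by rewrite ltrD2l gtrN.
have dF x : is_derive x (1 : R) F (g u x) by exact: derive_F.
have cF : continuous F.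
  move=> x; apply: differentiable_continuous; apply/derivable1_diffP.
  exact: (@ex_derive _ _ _ _ _ _ _ (dF x)).
have cth : continuous (th u).
  move=> x; apply: cvgD; last exact: cvg_cst.
  by apply: cvgM; [exact: cvg_cst|apply: cvgB; [exact: cvg_id|exact: cvg_cst]].
have cp : continuous p by exact: continuous_normal_pdf.
have cg : continuous (g u).
  move=> x; apply: cvgB; apply: cvgM.
  - by apply: cvgM; [apply: cvgB; [exact: cvg_id|exact: cvg_cst]|exact: cvg_cst].
  - apply: cvgM; last exact: cp.
    by apply: continuous_comp; [exact: cth|exact: continuous_sin].
  - exact: cvg_cst.
  - apply: cvgM; last exact: cp.
    by apply: continuous_comp; [exact: cth|exact: continuous_cos].
have FTC n : \int[mu]_(x in I n) g u x = F (m + n.+1%:R) - F (m - n.+1%:R).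
  rewrite /Rintegral (@continuous_FTC2 _ (g u) F)//.
  - by apply: continuous_subspaceT; exact: cg.
  - split.
    + by move=> x _; exact: (@ex_derive _ _ _ _ _ _ _ (dF x)).
    + by apply: cvg_at_right_filter; exact: cF.
    + by apply: cvg_at_left_filter; exact: cF.
  - by move=> x _; rewrite derive1E; exact: (@derive_val _ _ _ _ _ _ _ (dF x)).
(* From [exp y >= 1 + y >= y] follows [exp (-y) <= 1 / y]; this decay is enough. *)
have F0 (x : R) : x != m -> `|F x| <= normal_peak s * (s ^+ 2 *+ 2) / (x - m) ^+ 2.
  move=> xm; rewrite /F normrM normrN (ger0_norm (normal_pdf_ge0 _ _ _)).
  apply: le_trans (ler_piMl (normal_pdf_ge0 _ _ _) (norm_sin_le1 _)) _.
  rewrite /p normal_pdfE// -mulrA; apply: ler_wpM2l; first exact: normal_peak_ge0.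
  rewrite /normal_fun mulNr expRN -[leRHS]invrK invf_div.
  have xm0 : 0 < (x - m) ^+ 2 by rewrite exprn_even_gt0// subr_eq0.
  have y0 : 0 < (x - m) ^+ 2 / (s ^+ 2 *+ 2).
    by rewrite divr_gt0// pmulrn_lgt0// exprn_gt0.
  rewrite lef_pV2 ?posrE ?expR_gt0//.
  by apply: le_trans (expR_ge1Dx _); rewrite lerDr.
pose C := normal_peak s * (s ^+ 2 *+ 2).
have C0 : 0 <= C by rewrite mulr_ge0 ?normal_peak_ge0// mulrn_wge0// sqr_ge0.
have h0 : \int[mu]_(x in I n) g u x @[n --> \oo] --> 0.
  apply: norm_cvg0.
  apply: (@squeeze_cvgr _ _ _ _ (fun=> 0) (fun n => 2 * C * n.+1%:R^-1)).
  - apply: nearW => n; rewrite normr_ge0/= FTC.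
    have n0 : n.+1%:R != 0 :> R by rewrite pnatr_eq0.
    have b1 : `|F (m + n.+1%:R)| <= C / n.+1%:R ^+ 2.
      have /F0 : m + n.+1%:R != m by rewrite addrC -subr_eq0 addrK.
      by rewrite addrC addrK.
    have b2 : `|F (m - n.+1%:R)| <= C / n.+1%:R ^+ 2.
      have /F0 : m - n.+1%:R != m by rewrite addrC -subr_eq0 addrK oppr_eq0.
      by rewrite addrC addrK sqrrN.
    apply: le_trans (ler_normB _ _) _; apply: le_trans (lerD b1 b2) _.
    rewrite -mulr2n -[leLHS]mulr_natl mulrA; apply: ler_wpM2l; first by rewrite mulr_ge0.
    by rewrite lef_pV2 ?posrE ?exprn_gt0 ?ltr0n// ler_eXnr// ler1n.
  - exact: cvg_cst.
  - rewrite -[X in _ --> X](mulr0 (2 * C)); apply: cvgM; first exact: cvg_cst.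
    exact: cvg_harmonic.
have h1 : \int[mu]_(x in I n) g u x @[n --> \oo] --> \int[mu]_x g u x.
  have mE n : measurable_fun setT (EFin \o (g u \_ (I n))).
    apply/measurable_EFinP; apply: (measurable_restrictT _ _).1; first exact: measurable_itv.
    by apply: measurable_funTS; exact: continuous_measurable_fun.
  have mg : measurable_fun setT (EFin \o g u).
    by apply/measurable_EFinP; exact: continuous_measurable_fun.
  have ptw : {ae mu, forall x, setT x -> (EFin \o (g u \_ (I n))) x @[n --> \oo] --> (EFin \o g u) x}.
    apply: aeW => x _; apply: cvg_near_cst; near=> n.
    rewrite /= patchE mem_set// /I/= in_itv/=.
    have : `|x - m| <= n.+1%:R.
      near: n; near=> n; apply: (@le_trans _ _ n%:R); last by rewrite ler_nat.
      near: n; exact: nbhs_infty_ger.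
    by rewrite ler_norml => /andP[? ?]; apply/andP; split; lra.
  have bd : {ae mu, forall x, forall n, setT x -> (`|(EFin \o (g u \_ (I n))) x| <= (EFin \o (Num.Def.normr \o g u)) x)%E}.
    by apply: aeW => x n _; rewrite lee_fin/= patchE; case: ifP => _; rewrite ?normr0 ?normr_ge0.
  have [fi _ h] := @dominated_convergence _ _ _ mu setT measurableT
    (fun n => EFin \o (g u \_ (I n))) (EFin \o g u) _ mE mg ptw (integrable_norm ig) bd.
  rewrite (_ : (fun n => \int[mu]_(x in I n) g u x) = fun n => \int[mu]_x (g u \_ (I n)) x); last first.
    by apply/funext => n; rewrite Rintegral_mkcond.
  apply: fine_cvg; rewrite fineK; last exact: integrable_fin_num.
  exact: h.
exact: (cvg_unique _ h1 h0).
Unshelve. all: by end_near. Qed.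

Let ODE (u : R) : is_derive u (1 : R) A (- (s ^+ 2 * u * A u)).
Proof.
have s1 : s != 0 by rewrite gt_eqF.
have h : \int[mu]_x ((x - m) * sin (th u x) * p x) = s ^+ 2 * (u * A u).
  have := int_g u; rewrite /g.
  have -> : (fun x => (x - m) / s ^+ 2 * (sin (th u x) * p x) - u * (cos (th u x) * p x)) =
    (fun x => s ^- 2 * ((x - m) * sin (th u x) * p x) - u * (cos (th u x) * p x)).
    by apply/funext => x; ring.
  rewrite RintegralB//.
  - rewrite !RintegralZl// => /subr0_eq; rewrite -/(A u) => <-.
    by rewrite mulrA divff ?mul1r// expf_neq0.
  - exact: (@integrableZl _ _ _ mu setT measurableT (s ^- 2) _ (ixsin u)).
  - exact: (@integrableZl _ _ _ mu setT measurableT u _ (icos u)).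
have := derive_A u; rewrite h => dA; apply: is_derive_eq; by ring.
Qed.

Let A0 : A 0 = cos c.
Proof.
rewrite /A /th (_ : (fun x => _) = fun x => cos c * p x); last by apply/funext => x; rewrite mul0r add0r.
exact: Rintegral_normal_pdf.
Qed.

(** Differentiation under the integral and integration by parts give [A' = - s^2 u A] with
    [A 0 = cos c]. The integrating factor [exp (s^2 u^2 / 2)] turns [A] into a function with zero
    derivative. *)
Lemma normal_cf_center u : A u = cos c * expR (- (s ^+ 2 * u ^+ 2) / 2).
Proof.
pose E (u : R) := A u * expR (s ^+ 2 * u ^+ 2 / 2).
have dE (x : R) : is_derive x (1 : R) E 0.
  have dA := ODE x; rewrite /E; apply: is_derive_eq.
  rewrite /GRing.scale/=; by field.
have := is_derive_0_is_cst u 0 dE; rewrite /E A0 expr0n/= mulr0 mul0r expR0 mulr1 => <-.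
by rewrite -[RHS]mulrA -expRD mulNr subrr expR0 mulr1.
Qed.

End normal_cf.

Lemma normal_cf (m s u c : R) : 0 < s ->
  \int[normal_prob m s]_x cos (u * x + c) = cos (u * m + c) * expR (- (s ^+ 2 * u ^+ 2) / 2).
Proof.
move=> s0; rewrite (@integral_normal_prob _ _ _ 1).
- rewrite -(normal_cf_center m _ s0 u); apply: eq_Rintegral => x _.
  by congr (cos _ * _); ring.
- apply: (measurableT_comp (@measurable_cos R)).
  by apply: measurable_funD => //; exact: measurable_funM.
- by move=> x; exact: norm_cos_le1.
Qed.

End normal_law.

(** * Translations of Gaussian vectors *)

Section gaussian_vectors.
Context {R : realType}.

Lemma lipschitz_shift d (K : R) (G : 'rV[R]_d -> R) (x : 'rV[R]_d) :
  lipschitz_fun K G -> lipschitz_fun K (fun y => G (x + y)).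
Proof. by move=> lG y z; apply: le_trans (lG _ _) _; rewrite opprD addrACA subrr add0r. Qed.

Lemma dotV_ge0 d (v : 'rV[R]_d) : 0 <= dotV v v.
Proof. by apply: sumr_ge0 => i _; rewrite -expr2 sqr_ge0. Qed.

Lemma dotV_eq0 d (v : 'rV[R]_d) : dotV v v = 0 -> v = 0.
Proof.
move=> /eqP; rewrite psumr_eq0; last by move=> i _; rewrite -expr2 sqr_ge0.
move=> /allP h; apply/rowP => i; rewrite mxE; apply/eqP.
by have := h i (mem_index_enum i); rewrite /= -expr2 sqrf_eq0.
Qed.

Lemma sqrt_dotV_le d (v : 'rV[R]_d) : Num.sqrt (dotV v v) <= d.+1%:R * `|v|.
Proof.
have h0 : 0 <= d.+1%:R * `|v| by rewrite mulr_ge0.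
rewrite -(ger0_norm h0) -sqrtr_sqr ler_sqrt ?sqr_ge0// exprMn.
apply: (@le_trans _ _ (\sum_(i < d) `|v| ^+ 2)).
  apply: ler_sum => i _; rewrite -expr2 -(real_normK (num_real (v 0 i))).
  by rewrite lerXn2r ?nnegrE// rV_coord_le.
rewrite sumr_const card_ord -[leLHS]mulr_natl ler_wpM2r ?sqr_ge0// -natrX ler_nat.
by apply: (leq_trans (leqnSn d)); rewrite expnS leq_pmulr.
Qed.

Section gaussian.
Context {d : nat} {dO : measure_display} {Om : measurableType dO} (P : probability Om R)
  (V : Om -> 'rV[R]_d) (t : R).
Hypotheses (t0 : 0 < t) (rV : rvec V)
  (cf : forall u c, \int[P]_w cos (dotV u (V w) + c) = cos c * expR (- (t * dotV u u) / 2)).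

Let sq := Num.sqrt t.
Let sq0 : 0 < sq. Proof. by rewrite sqrtr_gt0. Qed.

Section direction.
Variables (e : 'rV[R]_d) (k : R).
Hypothesis e1 : dotV e e = 1.

(* The Gaussian component of V along e is resampled with mean k. *)
Let U (z : Om * measurableTypeR R) := V z.1 + (z.2 - dotV e (V z.1)) *: e.

Let rU : rvec U.
Proof.
have m1 : measurable_fun setT (fun z : Om * measurableTypeR R => dotV e (V z.1)).
  have := rvec_comp (@measurable_dotV R d e) rV.
  by move=> h; apply: (measurableT_comp h); exact: measurable_fst.
apply: rvec_coord => i; rewrite /U.
under eq_fun do rewrite !mxE.
apply: measurable_funD.
  by apply: (measurableT_comp (coord_rvec i rV)); exact: measurable_fst.
apply: measurable_funM => //; exact: measurable_funB.
Qed.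

Let dotU u z : dotV u (U z) = dotV u e * z.2 + dotV (u - dotV u e *: e) (V z.1).
Proof.
rewrite /U dotVC dotVDl dotVZl dotVDl dotVNl dotVZl (dotVC e u) (dotVC (V z.1) u); ring.
Qed.

(** With [a = u . e] and [u' = u - a e], the vector [u'] is orthogonal to the unit vector [e], so
    [|u'|^2 + a^2 = |u|^2]: the Gaussian factors of the remaining part and of the resampled part
    multiply to that of [V]. *)
Let cfU u c : \int[(P \x normal_prob k sq)%E]_z cos (dotV u (U z) + c) =
  \int[P]_w cos (dotV u (V w + k *: e) + c).
Proof.
have mU : measurable_fun setT (fun z => cos (dotV u (U z) + c)).
  apply: (measurableT_comp (@measurable_cos R)); apply: measurable_funD => //.
  exact: (rvec_comp (@measurable_dotV R d u) rU).
have [_ ->] := fubini_expectation P (normal_prob k sq) mU (fun z => norm_cos_le1 _).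
set a := dotV u e; set u' := u - a *: e.
have -> : (fun w => \int[normal_prob k sq]_y cos (dotV u (U (w, y)) + c)) =
   fun w => expR (- (sq ^+ 2 * a ^+ 2) / 2) * cos (dotV u' (V w) + (a * k + c)).
  apply/funext => w; rewrite mulrC.
  have -> : (fun y => cos (dotV u (U (w, y)) + c)) = fun y => cos (a * y + (dotV u' (V w) + c)).
    by apply/funext => y; rewrite dotU/= addrA.
  by rewrite normal_cf// addrCA.
rewrite RintegralZl//; last first.
  apply: (@bounded_integrable _ _ _ P (fun w => cos (dotV u' (V w) + (a * k + c))) 1) => [|w];
    last exact: norm_cos_le1.
  apply: (measurableT_comp (@measurable_cos R)); apply: measurable_funD => //.
  exact: (rvec_comp (@measurable_dotV R d u') rV).
rewrite cf.
have -> : (fun w => cos (dotV u (V w + k *: e) + c)) = fun w => cos (dotV u (V w) + (a * k + c)).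
  apply/funext => w; congr cos; rewrite dotVC dotVDl dotVZl (dotVC e u) (dotVC (V w) u) -/a; ring.
rewrite cf mulrCA -expRD; congr (_ * expR _).
rewrite /sq sqr_sqrtr ?(ltW t0)// /u' dotVDl dotVNl dotVZl !(dotVC _ (u - _)) !dotVDl !dotVNl !dotVZl e1.
rewrite (dotVC e u) -/a; by field.
Qed.

(** Shifting [V] along [e] becomes shifting the mean of a one-dimensional normal law, with [V]
    itself unchanged. *)
Lemma gaussian_resample (G : 'rV[R]_d -> R) (K : R) : lipschitz_fun K G -> (forall x, `|G x| <= 1) ->
  \int[P]_w G (V w + k *: e) =
  \int[P]_w \int[normal_prob k sq]_y G (V w + (y - dotV e (V w)) *: e).
Proof.
move=> lG G1.
have rVk : rvec (fun w => V w + k *: e) by apply: rvecD => //; exact: rvec_cst.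
rewrite -(cf_unique rU rVk cfU lG G1).
have mG : measurable_fun setT (fun z => G (U z)) by exact: (rvec_comp (lipschitz_borelV lG) rU).
by have [_ ->] := fubini_expectation P (normal_prob k sq) mG (fun z => G1 _).
Qed.

Lemma measurable_gaussian_resample (G : 'rV[R]_d -> R) (K : R) : lipschitz_fun K G -> (forall x, `|G x| <= 1) ->
  measurable_fun setT (fun w => \int[normal_prob k sq]_y G (V w + (y - dotV e (V w)) *: e)) /\
  forall w, measurable_fun setT (fun y : measurableTypeR R => G (V w + (y - dotV e (V w)) *: e)).
Proof.
move=> lG G1.
have mG : measurable_fun setT (fun z => G (U z)) by exact: (rvec_comp (lipschitz_borelV lG) rU).
split; first by have [] := fubini_expectation P (normal_prob k sq) mG (fun z => G1 _).
by move=> w; exact: (measurableT_comp mG (measurable_pair1 w)).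
Qed.

End direction.

(** With [r] the Euclidean length of [v], both expectations are written by resampling along [v / r],
    with means [r] and 0 and the same [V]; [normal_tv] then compares the inner integrals. *)
Lemma gaussian_shift (G : 'rV[R]_d -> R) (K : R) (v : 'rV[R]_d) :
  lipschitz_fun K G -> (forall x, `|G x| <= 1) ->
  `|\int[P]_w G (V w + v) - \int[P]_w G (V w)| <= 9 * (d.+1%:R * `|v| / sq).
Proof.
move=> lG G1; have [->|v0] := eqVneq v 0.
  rewrite (_ : (fun w => G (V w + 0)) = (fun w => G (V w))); last by apply/funext => w; rewrite addr0.
  by rewrite subrr !normr0 mulr0 mul0r mulr0.
set r := Num.sqrt (dotV v v).
have vv : 0 < dotV v v.
  rewrite lt_neqAle dotV_ge0 andbT eq_sym; apply: contra_neq v0; exact: dotV_eq0.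
have r0 : 0 < r by rewrite sqrtr_gt0.
have rr : r ^+ 2 = dotV v v by rewrite sqr_sqrtr// ltW.
pose e := r^-1 *: v.
have e1 : dotV e e = 1.
  by rewrite /e dotVZl dotVC dotVZl -rr; field; rewrite gt_eqF.
have vE : v = r *: e by rewrite scalerA divff ?gt_eqF// scale1r.
have -> : \int[P]_w G (V w + v) = \int[P]_w G (V w + r *: e) by rewrite -vE.
have -> : \int[P]_w G (V w) = \int[P]_w G (V w + 0 *: e).
  by apply: eq_Rintegral => w _; rewrite scale0r addr0.
rewrite !(gaussian_resample _ e1 lG G1).
have [mr mw] := @measurable_gaussian_resample e r _ _ lG G1.
have [m0 _] := @measurable_gaussian_resample e 0 _ _ lG G1.
have h1 k w : `|\int[normal_prob k sq]_y G (V w + (y - dotV e (V w)) *: e)| <= 1.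
  by apply: norm_expectation_le_bound => //; exact: mw.
apply: (expectation_dist mr m0 (h1 r) (h1 0)); apply: aeW => w.
apply: le_trans (normal_tv r sq0 (mw w) (fun y => G1 _)) _.
rewrite ler_pM2l// ler_pM2r ?invr_gt0// gtr0_norm//.
exact: sqrt_dotV_le.
Qed.

End gaussian.

Lemma wiener_lipschitz d dO (Om : measurableType dO) (P : probability Om R)
    (W : R -> Om -> 'rV[R]_d) (t : R) (G : 'rV[R]_d -> R) (K : R) (x y : 'rV[R]_d) :
  wiener P W -> 0 < t -> lipschitz_fun K G -> (forall z, `|G z| <= 1) ->
  `|\int[P]_w G (x + W t w) - \int[P]_w G (y + W t w)| <= 9 * d.+1%:R * `|x - y| / Num.sqrt t.
Proof.
move=> [[rW _ _] _ cW] t0 lG G1.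
have rWt : rvec (W t) by move=> B; exact: rW (ltW t0) B.
have mc u : measurable_fun setT (fun w => dotV u (W t w)) by exact: (rvec_comp (@measurable_dotV R d u) rWt).
have cf u c : \int[P]_w cos (dotV u (W t w) + c) = cos c * expR (- (t * dotV u u) / 2).
  have [h1 h2] := cW t u (ltW t0).
  have i1 : P.-integrable setT (EFin \o (fun w => cos (dotV u (W t w)))).
    apply: (@bounded_integrable _ _ _ P (fun w => cos (dotV u (W t w))) 1); first exact: (measurableT_comp (@measurable_cos R)).
    by move=> w; exact: norm_cos_le1.
  have i2 : P.-integrable setT (EFin \o (fun w => sin (dotV u (W t w)))).
    apply: (@bounded_integrable _ _ _ P (fun w => sin (dotV u (W t w))) 1); first exact: (measurableT_comp (@measurable_sin R)).
    by move=> w; exact: norm_sin_le1.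
  have -> : (fun w => cos (dotV u (W t w) + c)) = (fun w => cos c * cos (dotV u (W t w)) - sin c * sin (dotV u (W t w))).
    by apply/funext => w; rewrite cosD; ring.
  rewrite RintegralB// ?RintegralZl//.
  - by rewrite /Rintegral h1 h2/= mulr0 subr0.
  - exact: (@integrableZl _ _ _ P setT measurableT (cos c) _ i1).
  - exact: (@integrableZl _ _ _ P setT measurableT (sin c) _ i2).
have := gaussian_shift t0 rWt cf (x - y) (lipschitz_shift y lG) (fun z => G1 _).
rewrite (_ : (fun w => G (y + (W t w + (x - y)))) = fun w => G (x + W t w)); last first.
  by apply/funext => w; congr G; rewrite addrCA (addrC y) subrK addrC.
by rewrite !mulrA.
Qed.

End gaussian_vectors.

(** * Subordination *)

Section subordination.
Context {R : realType}.

Lemma exists_nat_cell (a : R) : 0 < a -> exists j : nat, j%:R < a <= j.+1%:R.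
Proof.
move=> a0.
have exm : exists m : nat, a <= m%:R.
  by exists (Num.bound a); apply/ltW; exact: archi_boundP (ltW a0).
have [[|j] aj hm] := ex_minnP exm; first by rewrite leNgt a0 in aj.
exists j; rewrite aj andbT ltNge; apply/negP => /hm.
by rewrite ltnn.
Qed.

Lemma nat_cell_uniq (a : R) (j k : nat) : j%:R < a <= j.+1%:R -> k%:R < a <= k.+1%:R -> j = k.
Proof.
move=> /andP[j1 j2] /andP[k1 k2]; apply/eqP; rewrite eqn_leq.
by apply/andP; split; rewrite -ltnS -(ltr_nat R); [exact: lt_le_trans k2|exact: lt_le_trans j2].
Qed.

(** Open on the left and closed on the right: the cells tile the positive half-line, and a point is
    approximated from above by the right endpoint of its cell. Then [1 / sqrt] does not increase,
    and right-continuous functions are well approximated. *)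
Definition cell (n k : nat) : set R := `]k%:R / n.+1%:R, k.+1%:R / n.+1%:R]%classic.

Lemma cellP n k r : cell n k r <-> k%:R < r * n.+1%:R <= k.+1%:R.
Proof.
rewrite /cell/= in_itv/= ltr_pdivrMr ?ltr0n//.
by rewrite ler_pdivlMr ?ltr0n.
Qed.

Lemma measurable_cell n k : measurable (cell n k). Proof. exact: measurable_itv. Qed.

Lemma cell_sum n N (q : nat -> R) r j : (j < N)%N -> cell n j r ->
  \sum_(k < N) \1_(cell n k) r * q k = q j.
Proof.
move=> jN cj; rewrite (bigD1 (Ordinal jN))//= indicE mem_set// mul1r big1 ?addr0// => k kj.
rewrite indicE memNset ?mul0r// => ck; move/eqP: kj; apply; apply/val_inj => /=.
by apply: (@nat_cell_uniq (r * n.+1%:R)); exact/cellP.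
Qed.

Lemma cell_sum0 n N (q : nat -> R) r : (forall j, (j < N)%N -> ~ cell n j r) ->
  \sum_(k < N) \1_(cell n k) r * q k = 0.
Proof.
move=> h; rewrite big1// => k _; rewrite indicE memNset ?mul0r//; exact: h.
Qed.

Lemma cell_cases n N r : (exists2 j, (j < N)%N & cell n j r) \/ (forall j, (j < N)%N -> ~ cell n j r).
Proof.
have [h|h] := pselect (exists2 j, (j < N)%N & cell n j r); [by left|right].
by move=> j jN cj; apply: h; exists j.
Qed.

Lemma measurable_inv_sqrt : measurable_fun setT (fun t : R => (Num.sqrt t)^-1).
Proof.
(* For [t <= 0] both functions are 0, since the square root of a nonpositive number and the inverse
   of 0 are 0 by convention. *)
pose f (t : R) := expR (- (ln t / 2)) * \1_`]0, +oo[ t.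
have -> : (fun t : R => (Num.sqrt t)^-1) = f.
  apply/funext => t; rewrite /f indicE; have [t0|t0] := ltP 0 t.
    rewrite mem_set/= ?in_itv/= ?t0// mulr1 expRN; congr (_^-1).
    apply/eqP; rewrite -(@eqrXn2 _ 2)// ?sqrtr_ge0 ?expR_ge0// sqr_sqrtr ?ltW//.
    by rewrite -expRM_natr mulfVK// lnK.
  rewrite memNset/= ?mulr0 ?ler0_sqrtr ?invr0//.
  by rewrite in_itv/= andbT; apply/negP; rewrite -leNgt.
apply: measurable_funM; last by apply: measurable_indic; exact: measurable_itv.
apply: measurableT_comp => //; apply: measurableT_comp => //; exact: measurable_funM.
Qed.

Section subordinated.
Context {d : nat} {dO : measure_display} {Om : measurableType dO} (P : probability Om R)
  (W : R -> Om -> 'rV[R]_d) (tau : Om -> R).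
Hypotheses (HW : wiener P W) (mtau : measurable_fun setT tau)
  (tau0 : {ae P, forall w, 0 < tau w})
  (indep : forall t A B, 0 <= t -> measurable A -> borelV d B ->
     P (tau @^-1` A `&` W t @^-1` B) = (P (tau @^-1` A) * P (W t @^-1` B))%E)
  (rY : rvec (fun w => W (tau w) w)).

Let rW t : 0 <= t -> rvec (W t).
Proof. by case: HW => -[rW _ _] _ _ t0 B; exact: rW. Qed.

Section estimate.
Variables (G : 'rV[R]_d -> R) (K : R) (x y : 'rV[R]_d).
Hypotheses (lG : lipschitz_fun K G) (G1 : forall z, `|G z| <= 1).
Hypothesis Hphi : (\int[P]_w ((Num.sqrt (tau w))^-1)%:E < +oo)%E.

Let q (v : 'rV[R]_d) := G (x + v) - G (y + v).

Let mq : measurable_fun setT (q : borel_rV R d -> R).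
Proof. by apply: measurable_funB; apply: lipschitz_borelV; exact: lipschitz_shift lG. Qed.

Let q2 v : `|q v| <= 2.
Proof. by apply: le_trans (ler_normB _ _) _; rewrite (_ : 2 = 1 + 1)// lerD. Qed.

Let time (n k : nat) : R := k.+1%:R / n.+1%:R.

Let time0 n k : 0 < time n k. Proof. by rewrite divr_gt0 ?ltr0n. Qed.

Let N n := (n.+1 ^ 2)%N.

(** The value of [q] along [W] with [tau] rounded up to the grid of mesh [1/(n+1)] on []0, n+1]],
    and 0 outside that range. Each term involves [W] at one fixed time, where independence from
    [tau] is available. *)
Let h n w := \sum_(k < N n) \1_(cell n k) (tau w) * q (W (time n k) w).

Let mind n k : measurable_fun setT (fun w => \1_(cell n k) (tau w) : R).
Proof. by apply: measurableT_comp => //; apply: measurable_indic; exact: measurable_cell. Qed.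

Let mqW n k : measurable_fun setT (fun w => q (W (time n k) w)).
Proof. by apply: (rvec_comp mq); apply: rW; exact/ltW/time0. Qed.

Let mterm n k : measurable_fun setT (fun w => \1_(cell n k) (tau w) * q (W (time n k) w)).
Proof. exact: measurable_funM. Qed.

Let mh n : measurable_fun setT (h n).
Proof. by apply: measurable_sum => k; exact: mterm. Qed.

Let h2 n w : `|h n w| <= 2.
Proof.
have [[j jN cj]|H] := cell_cases n (N n) (tau w).
  by rewrite /h (@cell_sum n (N n) (fun k => q (W (time n k) w)) _ j).
by rewrite /h (@cell_sum0 n (N n) (fun k => q (W (time n k) w)))// normr0.
Qed.

Let cq : continuous q.
Proof.
apply: (@lipschitz_fun_continuous _ _ (K + K)) => u v.
have -> : q u - q v = (G (x + u) - G (x + v)) - (G (y + u) - G (y + v)) by rewrite /q; ring.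
apply: le_trans (ler_normB _ _) _; rewrite mulrDl; apply: lerD; exact: (lipschitz_shift _ lG).
Qed.

Let hcvg : {ae P, forall w, h n w @[n --> \oo] --> q (W (tau w) w)}.
Proof.
case: HW => _ cW _.
apply: filterS2 cW tau0 => w cw t0.
have {}cw : q (W t w) @[t --> tau w] --> q (W (tau w) w).
  apply: (@cvg_comp _ _ _ (fun t => W t w) q); last exact: cq.
  by apply: cw; rewrite inE/= ltW.
apply/cvgrPdist_le => e e0.
have /cvgrPdist_le/(_ e e0)/nbhs_ballP[r /= r0 hr] := cw.
near=> n.
have [j] := exists_nat_cell (mulr_gt0 t0 (ltr0n R n.+1)).
move=> cj; have jc := (cellP n j (tau w)).2 cj.
have jN : (j < N n)%N.
  have /andP[j1 _] := cj; rewrite -(ltr_nat R); apply: lt_le_trans j1 _.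
  rewrite /N natrX expr2 ler_pM2r ?ltr0n//.
  apply: (@le_trans _ _ n%:R); last by rewrite ler_nat.
  by near: n; exact: nbhs_infty_ger.
rewrite /h (@cell_sum n (N n) (fun k => q (W (time n k) w)) _ j)//.
apply: hr; rewrite -ball_normE /ball_/=.
have nS : n.+1%:R^-1 < r by near: n; exact: (near_infty_natSinv_lt (PosNum r0)).
apply: le_lt_trans nS.
move: jc; rewrite /cell/= in_itv/= => /andP[c1 c2].
rewrite distrC ger0_norm ?subr_ge0// /time lerBlDr.
by apply: le_trans (lerD (lexx _) (ltW c1)); rewrite -natr1 mulrDl mul1r addrC.
Unshelve. all: by end_near. Qed.

Let C := 9 * d.+1%:R * `|x - y|.
Let C0 : 0 <= C. Proof. by rewrite !mulr_ge0. Qed.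

(** By independence the expectation factors into the probability of the cell and a difference of two
    expectations at a fixed time, to which [wiener_lipschitz] applies. *)
Let expectation_term n k : `|\int[P]_w (\1_(cell n k) (tau w) * q (W (time n k) w))| <=
  \int[P]_w (\1_(cell n k) (tau w) * (C / Num.sqrt (time n k))).
Proof.
have tk := ltW (time0 n k).
have rWt := rW tk; have mWt := (rvec_measurable_fun _).1 rWt.
have mf : measurable_fun setT (fun z : R * borel_rV R d => \1_(cell n k) z.1 * q z.2).
  apply: measurable_funM; first by apply: measurableT_comp => //; apply: measurable_indic; exact: measurable_cell.
  by apply: (measurableT_comp mq); exact: measurable_snd.
have fM (z : R * borel_rV R d) : `|\1_(cell n k) z.1 * q z.2| <= 2.
  rewrite normrM -[leRHS]mul1r ler_pM// indicE; case: (_ \in _); rewrite ?normr1 ?normr0//.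
rewrite (expectation_indep mtau mWt (fun A B mA mB => indep tk mA mB) mf fM)/=.
have qi : P.-integrable setT (EFin \o (fun w => q (W (time n k) w))).
  by apply: (@bounded_integrable _ _ _ P _ (2)) => // w; exact: q2.
have -> : (fun w => \int[P]_w' (\1_(cell n k) (tau w) * q (W (time n k) w'))) =
    (fun w => \1_(cell n k) (tau w) * \int[P]_w' q (W (time n k) w')).
  by apply/funext => w; rewrite RintegralZl.
have ii : P.-integrable setT (EFin \o (fun w => \1_(cell n k) (tau w) : R)).
  apply: (@bounded_integrable _ _ _ P _ (1)) => // w.
  by rewrite indicE; case: (_ \in _); rewrite ?normr1 ?normr0.
rewrite !RintegralZr// normrM; apply: ler_pM => //.
  by rewrite ger0_norm// Rintegral_ge0// => w _; rewrite indicE.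
rewrite /q RintegralB//.
- apply: le_trans (wiener_lipschitz x y HW (time0 n k) lG G1) _.
  by rewrite /C.
- apply: (@bounded_integrable _ _ _ P (fun w => G (x + W (time n k) w)) 1) => //.
  by apply: (rvec_comp (f := fun v => G (x + v))) => //; apply: lipschitz_borelV; exact: lipschitz_shift lG.
- apply: (@bounded_integrable _ _ _ P (fun w => G (y + W (time n k) w)) 1) => //.
  by apply: (rvec_comp (f := fun v => G (y + v))) => //; apply: lipschitz_borelV; exact: lipschitz_shift lG.
Qed.

Let mphi : measurable_fun setT (fun w => (Num.sqrt (tau w))^-1).
Proof. exact: (measurableT_comp measurable_inv_sqrt mtau). Qed.

Let iphi : P.-integrable setT (EFin \o (fun w => (Num.sqrt (tau w))^-1)).
Proof.
apply/integrableP; split; first exact/measurable_EFinP.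
apply: le_lt_trans Hphi; apply: ge0_le_integral => //.
- by apply: measurableT_comp => //; exact/measurable_EFinP.
- exact/measurable_EFinP.
- by move=> w _ /=; rewrite lee_fin ger0_norm// invr_ge0 sqrtr_ge0.
Qed.

Let expectation_h n : `|\int[P]_w h n w| <= C * \int[P]_w (Num.sqrt (tau w))^-1.
Proof.
have iterm k : P.-integrable setT (EFin \o (fun w => \1_(cell n k) (tau w) * q (W (time n k) w))).
  apply: (@bounded_integrable _ _ _ P _ (2)) => // w.
  rewrite normrM -[leRHS]mul1r ler_pM// indicE; case: (_ \in _); rewrite ?normr1 ?normr0//.
have ibd k : P.-integrable setT (EFin \o (fun w => \1_(cell n k) (tau w) * (C / Num.sqrt (time n k)))).
  apply: (@bounded_integrable _ _ _ P _ (`|C / Num.sqrt (time n k)|)); first exact: measurable_funM.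
  by move=> w; rewrite normrM ler_piMl// indicE; case: (_ \in _); rewrite ?normr1 ?normr0.
have sumE (f : nat -> Om -> R) : (forall k, P.-integrable setT (EFin \o f k)) -> forall M,
    \int[P]_w (\sum_(k < M) f k w) = \sum_(k < M) \int[P]_w f k w /\
    P.-integrable setT (EFin \o (fun w => \sum_(k < M) f k w)).
  move=> fi; elim=> [|M [IH1 IH2]].
    rewrite big_ord0; split; last by under eq_fun do rewrite big_ord0; exact: integrable0.
    by under eq_Rintegral do rewrite big_ord0; rewrite Rexpectation_cst.
  rewrite big_ord_recr/= -IH1 -RintegralD//; split.
    by apply: eq_Rintegral => w _; rewrite big_ord_recr.
  rewrite (_ : _ \o _ = EFin \o (fun w => \sum_(k < M) f k w + f M w)); last first.
    by apply/funext => w /=; rewrite big_ord_recr.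
  exact: (integrableD measurableT IH2 (fi M)).
rewrite /h (sumE _ iterm (N n)).1.
apply: le_trans (ler_norm_sum _ _ _) _.
apply: (@le_trans _ _ (\sum_(k < N n) \int[P]_w (\1_(cell n k) (tau w) * (C / Num.sqrt (time n k))))).
  by apply: ler_sum => k _; exact: expectation_term.
rewrite -(sumE _ ibd (N n)).1 -RintegralZl//.
apply: le_Rintegral => //.
- exact: (sumE _ ibd (N n)).2.
- exact: (@integrableZl _ _ _ P setT measurableT C _ iphi).
- move=> w _; have [[j jN cj]|H] := cell_cases n (N n) (tau w).
    (* On its cell [tau] is at most the right endpoint, so [1 / sqrt] at the endpoint is bounded by
       [1 / sqrt tau]. *)
    rewrite (@cell_sum n (N n) (fun k => C / Num.sqrt (time n k)) _ j)//.
    apply: ler_wpM2l => //; move: cj; rewrite /cell/= in_itv/= => /andP[c1 c2].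
    have tw : 0 < tau w by apply: le_lt_trans c1; rewrite divr_ge0.
    rewrite lef_pV2 ?posrE ?sqrtr_gt0// ler_sqrt//.
    exact/ltW/time0.
  by rewrite (@cell_sum0 n (N n) (fun k => C / Num.sqrt (time n k)))// mulr_ge0// invr_ge0 sqrtr_ge0.
Qed.

(** The discretised expectations satisfy the bound for every [n]; path continuity and dominated
    convergence carry it to [W] at time [tau]. *)
Lemma subordinated_lipschitz :
  `|\int[P]_w G (x + W (tau w) w) - \int[P]_w G (y + W (tau w) w)| <=
  9 * d.+1%:R * `|x - y| * \int[P]_w (Num.sqrt (tau w))^-1.
Proof.
have mG v : measurable_fun setT (fun w => G (v + W (tau w) w)).
  by apply: (rvec_comp (f := fun z => G (v + z))) => //; apply: lipschitz_borelV; exact: lipschitz_shift lG.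
rewrite (RexpectationB _ (mG x) (mG y) (fun w => G1 _) (fun w => G1 _)).
have cv : \int[P]_w h n w @[n --> \oo] --> \int[P]_w q (W (tau w) w).
  by apply: (expectation_cvg mh _ h2 hcvg); exact: (rvec_comp mq rY).
have cvn : `|\int[P]_w h n w| @[n --> \oo] --> `|\int[P]_w q (W (tau w) w)| by exact: cvg_norm.
by apply: (cvgr_to_le cvn); apply: nearW => n; exact: expectation_h.
Qed.

End estimate.
End subordinated.
End subordination.

(** * Weak solutions over a short time *)

Section weak_solutions.
Context {R : realType}.
Local Notation mu := (@lebesgue_measure R).

(** Limit of step functions sampled at the right endpoints of the cells. The cells leave out 0,
    hence the separate term for it. *)
Lemma right_continuous_measurable (f : R -> R) :
  (forall t, 0 <= t -> f x @[x --> t^'+] --> f t) -> measurable_fun (`[(0 : R), +oo[%classic : set R) f.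
Proof.
move=> rc.
pose g (n : nat) (r : R) : R := \1_[set 0] r * f 0 + \sum_(k < (n.+1 ^ 2)%N) \1_(cell n k) r * f (k.+1%:R / n.+1%:R).
apply: (@measurable_fun_cvg _ _ _ _ g).
  move=> n; apply: measurable_funTS; apply: measurable_funD.
    by apply: measurable_funM => //; apply: measurable_indic; exact: measurable_set1.
  by apply: measurable_sum => k; apply: measurable_funM => //; apply: measurable_indic; exact: measurable_cell.
move=> r /=; rewrite in_itv/= andbT le_eqVlt => /predU1P[<-|r0].
  apply: cvg_near_cst; apply: nearW => n; rewrite /g indicE mem_set// mul1r.
  rewrite (@cell_sum0 _ n _ (fun k => f (k.+1%:R / n.+1%:R))) ?addr0// => j _ /cellP.
  by rewrite mul0r ltNge ler0n.
apply/cvgrPdist_le => e e0.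
have /cvgrPdist_le/(_ e e0) := rc r (ltW r0).
rewrite near_withinE => /nbhs_ballP[eta /= eta0 h].
near=> n.
have [j cj] := exists_nat_cell (mulr_gt0 r0 (ltr0n R n.+1)).
have jc := (cellP n j r).2 cj.
have jN : (j < n.+1 ^ 2)%N.
  have /andP[j1 _] := cj; rewrite -(ltr_nat R); apply: lt_le_trans j1 _.
  rewrite natrX expr2 ler_pM2r ?ltr0n//.
  apply: (@le_trans _ _ n%:R); last by rewrite ler_nat.
  by near: n; exact: nbhs_infty_ger.
rewrite /g indicE memNset ?mul0r ?add0r; last by move=> /= r00; rewrite r00 ltxx in r0.
rewrite (@cell_sum _ n _ (fun k => f (k.+1%:R / n.+1%:R)) _ j)//.
move: jc; rewrite /cell/= in_itv/= => /andP[c1].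
rewrite le_eqVlt => /predU1P[<-|c2]; first by rewrite subrr normr0 ltW.
apply: h => //; rewrite -ball_normE /ball_/=.
have nS : n.+1%:R^-1 < eta by near: n; exact: (near_infty_natSinv_lt (PosNum eta0)).
apply: le_lt_trans nS.
rewrite distrC ger0_norm ?subr_ge0 ?(ltW c2)// lerBlDr.
by apply: le_trans (lerD (lexx _) (ltW c1)); rewrite -natr1 mulrDl mul1r addrC.
Unshelve. all: by end_near. Qed.

(** Right-continuity makes each coordinate of [b] along the path measurable, and boundedness makes
    it integrable, so that the difference of the two integrals is the integral over []s, s + r]]. *)
Lemma vint_increment d (b : 'rV[R]_d -> 'rV[R]_d) (M : R) (g : R -> 'rV[R]_d) (s r : R) :
  continuous b -> (forall x, `|b x| <= M) ->
  (forall t, 0 <= t -> g x @[x --> t^'+] --> g t) -> 0 <= s -> 0 <= r ->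
  `|vint (s + r) (fun t => b (g t)) - vint s (fun t => b (g t))| <= M * r.
Proof.
move=> cb bM rg s0 r0.
have M0 : 0 <= M by apply: le_trans (bM 0).
apply: rV_norm_le => [|i]; first exact: mulr_ge0.
rewrite !mxE.
pose f t := b (g t) 0 i.
have fM t : `|f t| <= M by apply: le_trans (rV_coord_le _ _) (bM _).
have mf : measurable_fun (`[(0 : R), +oo[%classic : set R) f.
  apply: right_continuous_measurable => t t0.
  apply: (@cvg_comp _ _ _ g (fun v => b v 0 i)); first exact: rg.
  by apply: (@continuous_comp _ _ _ b (fun v => v 0 i)); [exact: cb|exact: coord_continuous].
have fi : mu.-integrable `[0, s + r] (EFin \o f).
  apply: measurable_bounded_integrable => //.
  - by rewrite /= lebesgue_measure_itv/=; case: ifP => _; rewrite ?ltry.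
  - apply: measurable_funS mf => //; apply: subset_itvl => //.
  - exists M; split; first exact: num_real.
    by move=> x Mx t _ /=; apply: le_trans (fM t) (ltW Mx).
have -> : fine (\int[mu]_(t in `[0%R, (s + r)%R]) (f t)%:E)%E + - fine (\int[mu]_(t in `[0%R, s]) (f t)%:E)%E
    = \int[mu]_(t in `]s, s + r]) f t.
  by rewrite -(Rintegral_itvB fi)// bnd_simp ?lerDl.
have fi' : mu.-integrable `]s, s + r] (EFin \o f).
  by apply: integrableS fi => //; apply: subset_itvr; rewrite bnd_simp.
apply: le_trans (le_normr_Rintegral _ fi') _ => //.
apply: (@le_trans _ _ (\int[mu]_(t in `]s, s + r]) M)).
  apply: le_Rintegral => //; first exact: (integrable_norm fi').
  apply: measurable_bounded_integrable => //.
  - by rewrite /= lebesgue_measure_itv/=; case: ifP => _; rewrite ?ltry.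
  - by exists M; split; [exact: num_real|move=> x Mx t _ /=; rewrite ger0_norm// ltW].
rewrite Rintegral_cst// /= lebesgue_measure_itv/= lte_fin ltrDl; case: ifP => [|/negbT].
  by move=> _; rewrite /= addrAC subrr add0r.
by rewrite -leNgt => r1; rewrite /= mulr0 mulr_ge0.
Qed.

(** The operators [Q_s] of the overview; [conv_sgD] shows that they form a convolution semigroup. *)
Definition conv_sg d {dO} {Om : measurableType dO} (P : probability Om R)
    (Z : R -> Om -> 'rV[R]_d) (s : R) (g : 'rV[R]_d -> R) (x : 'rV[R]_d) : R :=
  \int[P]_w g (x + Z s w).

Section convolution.
Context {d : nat} {dO : measure_display} {Om : measurableType dO} (P : probability Om R)
  (Z : R -> Om -> 'rV[R]_d).
Hypothesis rZ : forall s, 0 <= s -> rvec (Z s).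
Implicit Types g : 'rV[R]_d -> R.

Lemma rvec_shift s x : 0 <= s -> rvec (fun w => x + Z s w).
Proof. by move=> s0; apply: rvecD; [exact: rvec_cst|exact: rZ]. Qed.

Lemma conv_sg_norm_le1 s g K x : 0 <= s -> lipschitz_fun K g -> (forall z, `|g z| <= 1) ->
  `|conv_sg P Z s g x| <= 1.
Proof.
move=> s0 lg g1; apply: norm_expectation_le_bound => //.
by apply: (rvec_comp (lipschitz_borelV lg)); exact: rvec_shift.
Qed.

Lemma conv_sg_lipschitz s g K : 0 <= s -> lipschitz_fun K g -> (forall z, `|g z| <= 1) ->
  lipschitz_fun K (conv_sg P Z s g).
Proof.
move=> s0 lg g1 x y; have mg v := rvec_comp (lipschitz_borelV lg) (rvec_shift v s0).
apply: (expectation_dist (mg x) (mg y) (fun=> g1 _) (fun=> g1 _)); apply: aeW => w.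
by apply: le_trans (lg _ _) _; rewrite opprD addrACA subrr addr0.
Qed.

End convolution.

Section one_step.
Context {d : nat} {d0 : measure_display} {Om0 : measurableType d0} (P0 : probability Om0 R)
  (Z : R -> Om0 -> 'rV[R]_d)
  {dO : measure_display} {Om : measurableType dO} (P : probability Om R)
  (F : R -> set (set Om)) (Z' X : R -> Om -> 'rV[R]_d).
Hypotheses (rZ : forall s, 0 <= s -> rvec (Z s))
  (FF : filtration F) (FZ : F_levy P F Z') (law : same_law P Z' P0 Z).

Let law1 s B : 0 <= s -> borelV d B -> P (Z' s @^-1` B) = P0 (Z s @^-1` B).
Proof.
move=> s0 bB; have := @law 1%N (fun=> s) (fun=> B) (fun=> s0) (fun=> bB).
by rewrite !bigcap_mkord !big_ord1.
Qed.

Let rZ' s : 0 <= s -> rvec (Z' s).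
Proof. by case: FZ => -[+ _ _] _ _ s0 B bB; apply. Qed.

Let lawD s r B : 0 <= s -> 0 <= r -> borelV d B ->
  P ((fun w => Z' (s + r) w - Z' s w) @^-1` B) = P0 (Z r @^-1` B).
Proof.
move=> s0 r0 bB; rewrite -law1//.
case: FZ => -[_ _ [_ + _ _]] _ _ => /(_ s (s + r) B s0 _ bB).
by rewrite lerDl r0 (addrC s) addrK => /(_ isT).
Qed.

Let rD s r : 0 <= s -> 0 <= r -> rvec (fun w => Z' (s + r) w - Z' s w).
Proof. by move=> s0 r0; apply: rvecB; apply: rZ' => //; exact: addr_ge0. Qed.

(** The increment of [Z'] is independent of [F s] and, by stationarity, distributed as [Z' r];
    equality of laws then moves the inner expectation to the space that carries [Z]. *)
Lemma expectation_increment s r (U : Om -> 'rV[R]_d) (g : 'rV[R]_d -> R) (K : R) :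
  0 <= s -> 0 <= r -> (forall B, borelV d B -> F s (U @^-1` B)) ->
  lipschitz_fun K g -> (forall z, `|g z| <= 1) ->
  \int[P]_w g (U w + (Z' (s + r) w - Z' s w)) = \int[P]_w conv_sg P0 Z r g (U w).
Proof.
move=> s0 r0 FU lg g1.
have rU : rvec U by move=> B bB; case: FF => _ FS _; exact: FS (FU B bB).
have mg := lipschitz_borelV lg.
rewrite (expectation_indepD rU (rD s0 r0) _ mg g1); last first.
  move=> A B bA bB; case: FZ => _ _ h.
  by apply: (h s (s + r) _ B s0 _ (FU A bA) bB); rewrite lerDl.
apply: eq_Rintegral => w _; rewrite /conv_sg.
apply: (@expectation_same_law _ _ _ _ _ P P0 _ (borel_rV R d) _ (Z r) (fun z => g (U w + z)) 1) => //.
- exact/rvec_measurable_fun/rD.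
- exact/rvec_measurable_fun/rZ.
- by move=> A bA; exact: lawD.
- by apply: (@lipschitz_borelV _ _ K); exact: lipschitz_shift.
Qed.

(** Read off from [Z'], whose increments are governed by [F_levy], with [U = x + Z' s] in
    [expectation_increment], and transferred by equality of laws. This spares a proof that the sum
    of the subordinated process and [xi] is a Lévy process. *)
Lemma conv_sgD s r g K x : 0 <= s -> 0 <= r -> lipschitz_fun K g -> (forall z, `|g z| <= 1) ->
  conv_sg P0 Z (s + r) g x = conv_sg P0 Z s (conv_sg P0 Z r g) x.
Proof.
move=> s0 r0 lg g1.
have transfer u (f : 'rV[R]_d -> R) K' : 0 <= u -> lipschitz_fun K' f -> (forall z, `|f z| <= 1) ->
    conv_sg P0 Z u f x = \int[P]_w f (x + Z' u w).
  move=> u0 lf f1; apply/esym.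
  apply: (@expectation_same_law _ _ _ _ _ P P0 _ (borel_rV R d) _ (Z u) (fun z => f (x + z)) 1) => //.
  - exact/rvec_measurable_fun/rZ'.
  - exact/rvec_measurable_fun/rZ.
  - by move=> A bA; exact: law1.
  - by apply: (@lipschitz_borelV _ _ K'); exact: lipschitz_shift.
rewrite (transfer _ _ K)//; last exact: addr_ge0.
rewrite (transfer _ _ K)//; last 2 first.
- exact: conv_sg_lipschitz.
- by move=> z; apply: conv_sg_norm_le1 lg g1.
rewrite -(@expectation_increment s r (fun w => x + Z' s w) g K)//.
  by apply: eq_Rintegral => w _; rewrite -addrA [Z' s w + _]addrC subrK.
move=> B bB; case: FZ => _ aZ _.
apply: (aZ s ((fun z => x + z) @^-1` B) s0).
by apply: (@rvecD _ _ _ (borel_rV R d) (fun=> x) id) => //; exact: rvec_cst.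
Qed.

Lemma conv_sg0 g K x : lipschitz_fun K g -> (forall z, `|g z| <= 1) -> conv_sg P0 Z 0 g x = g x.
Proof.
move=> lg g1.
have -> : conv_sg P0 Z 0 g x = \int[P]_w g (x + Z' 0 w).
  apply/esym; apply: (@expectation_same_law _ _ _ _ _ P P0 _ (borel_rV R d) _ (Z 0) (fun z => g (x + z)) 1) => //.
  - exact/rvec_measurable_fun/rZ'.
  - exact/rvec_measurable_fun/rZ.
  - by move=> A bA; exact: law1.
  - by apply: (@lipschitz_borelV _ _ K); exact: lipschitz_shift.
rewrite -[RHS](Rexpectation_cst P); congr fine; apply: ae_eq_integral => //.
  apply/measurable_EFinP; apply: (rvec_comp (lipschitz_borelV lg)); apply: rvecD; first exact: rvec_cst.
  exact: rZ'.
by case: FZ => -[_ + _] _ _; apply: filterS => w h _ /=; rewrite h addr0.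
Qed.

Section drift.
Variables (b : 'rV[R]_d -> 'rV[R]_d) (M : R) (x : 'rV[R]_d).
Hypotheses (cb : continuous b) (bM : forall z, `|b z| <= M)
  (aX : adapted F X) (cX : {ae P, forall w, cadlag (fun t => X t w)})
  (sde : {ae P, forall w, forall t, 0 <= t -> X t w = x + vint t (fun s => b (X s w)) + Z' t w}).

Lemma adapted_rvec s : 0 <= s -> rvec (X s).
Proof. by move=> s0 B bB; case: FF => _ FS _; apply: (FS s); exact: aX. Qed.

(** By the equation, [X (s + r)] and [X s] plus the noise increment differ almost surely by a drift
    integral over a time [r], of norm at most [M r]. *)
Lemma drift_step s r g K : 0 <= s -> 0 <= r -> 0 <= K -> lipschitz_fun K g -> (forall z, `|g z| <= 1) ->
  `|\int[P]_w g (X (s + r) w) - \int[P]_w conv_sg P0 Z r g (X s w)| <= K * (M * r).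
Proof.
move=> s0 r0 K0 lg g1.
rewrite -(@expectation_increment s r (X s) g K)//; last by move=> B bB; exact: aX.
have mg := lipschitz_borelV lg.
apply: (@expectation_dist _ _ _ P _ _ 1) => //.
- by apply: (rvec_comp mg); apply: adapted_rvec; exact: addr_ge0.
- by apply: (rvec_comp mg); apply: rvecD; [exact: adapted_rvec|exact: rD].
apply: filterS2 cX sde => w [rc _] eqX.
apply: le_trans (lg _ _) _; apply: ler_wpM2l => //.
rewrite (eqX (s + r)) ?addr_ge0// (eqX s)//.
set v1 := vint (s + r) _; set v2 := vint s _.
have -> : x + v1 + Z' (s + r) w - (x + v2 + Z' s w + (Z' (s + r) w - Z' s w)) = v1 - v2.
  by clearbody v1 v2; apply/matrixP => i j; rewrite !mxE; ring.
exact: vint_increment.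
Qed.

Section telescoping.
Variables (psi : R -> R) (C : R) (g : 'rV[R]_d -> R) (K : R) (t h : R).
Hypotheses (C0 : 0 <= C) (K0 : 0 <= K) (lg : lipschitz_fun K g) (g1 : forall z, `|g z| <= 1)
  (h0 : 0 < h) (ht : h <= t) (psi0 : forall s, 0 <= psi s)
  (lip : forall s, 0 < s -> s <= h -> lipschitz_fun (C * psi s) (conv_sg P0 Z s g)).

(** [D k] is the expectation at time [t - k eta] of [g] smoothed for a time [k eta]. Passing from
    [D k] to [D (k+1)] costs [M eta] times the Lipschitz constant of the smoothed function,
    [C psi (k eta)]; for [k = 0] nothing is smoothed and the cost is [K M eta], which vanishes with
    the mesh. *)
Lemma telescoping (n : nat) :
  `|\int[P]_w g (X t w) - \int[P]_w conv_sg P0 Z h g (X (t - h) w)| <=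
  M * (K * (h / n.+1%:R) + C * \sum_(j < n) h / n.+1%:R * psi (j.+1%:R * (h / n.+1%:R))).
Proof.
set eta := h / n.+1%:R.
have eta0 : 0 < eta by rewrite divr_gt0.
have nh : n.+1%:R * eta = h by rewrite mulrC divfK// pnatr_eq0.
have M0 : 0 <= M by apply: le_trans (bM 0).
have th0 : 0 <= t - h by rewrite subr_ge0.
pose D (k : nat) := \int[P]_w conv_sg P0 Z (k%:R * eta) g (X (t - k%:R * eta) w).
have keh k : (k <= n.+1)%N -> k%:R * eta <= h.
  by move=> kn; rewrite -nh ler_pM2r// ler_nat.
have step k (L : R) : (k <= n)%N -> 0 <= L -> lipschitz_fun L (conv_sg P0 Z (k%:R * eta) g) ->
    `|D k - D k.+1| <= L * (M * eta).
  move=> kn L0 lL; rewrite /D.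
  have k0 : 0 <= k%:R * eta by rewrite mulr_ge0// ltW.
  have s0 : 0 <= t - k.+1%:R * eta.
    by rewrite subr_ge0; apply: le_trans (keh k.+1 kn) ht.
  have := drift_step s0 (ltW eta0) L0 lL (fun z => conv_sg_norm_le1 P0 rZ _ k0 lg g1).
  have -> : t - k.+1%:R * eta + eta = t - k%:R * eta by rewrite -natr1; ring.
  have -> : (fun w => conv_sg P0 Z eta (conv_sg P0 Z (k%:R * eta) g) (X (t - k.+1%:R * eta) w)) =
    (fun w => conv_sg P0 Z (k.+1%:R * eta) g (X (t - k.+1%:R * eta) w)).
    apply/funext => w; rewrite -(conv_sgD _ (ltW eta0) k0 lg g1).
    by congr (conv_sg P0 Z _ g _); rewrite -natr1; ring.
  by [].
have -> : \int[P]_w g (X t w) = D 0%N.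
  by rewrite /D mul0r subr0; apply: eq_Rintegral => w _; rewrite (conv_sg0 _ lg g1).
have -> : \int[P]_w conv_sg P0 Z h g (X (t - h) w) = D n.+1 by rewrite /D nh.
have H m : (m <= n)%N -> `|D 0%N - D m.+1| <= M * (K * eta + C * \sum_(j < m) eta * psi (j.+1%:R * eta)).
  elim: m => [|m IH] mn.
    rewrite big_ord0 mulr0 addr0; apply: le_trans (step 0%N K _ _ _) _ => //.
      by rewrite mul0r; exact: conv_sg_lipschitz.
    by rewrite mulrCA.
  have -> : D 0%N - D m.+2 = (D 0%N - D m.+1) + (D m.+1 - D m.+2) by rewrite addrA subrK.
  apply: le_trans (ler_normD _ _) _.
  have me0 : 0 < m.+1%:R * eta by rewrite mulr_gt0.
  have meh : m.+1%:R * eta <= h by apply: keh; exact: leqW.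
  have st := step m.+1 (C * psi (m.+1%:R * eta)) mn (mulr_ge0 C0 (psi0 _)) (lip me0 meh).
  apply: le_trans (lerD (IH (ltnW mn)) st) _.
  by rewrite big_ord_recr/= le_eqVlt; apply/orP; left; apply/eqP; ring.
exact: H.
Qed.

End telescoping.
End drift.
End one_step.
End weak_solutions.

(** * Integrals of nonincreasing functions with a singularity at 0 *)

Section monotone_functions.
Context {R : realType}.
Local Notation mu := (@lebesgue_measure R).

Section monotone_integrable.
Variables (phi : R -> \bar R) (delta : R).
Hypotheses (delta0 : 0 < delta) (phi0 : forall s, (0 <= phi s)%E)
  (phi_noninc : forall s t, 0 < s -> s <= t -> t <= delta -> (phi t <= phi s)%E)
  (phi_int : (\int[mu]_(s in `[0%R, delta]) phi s < +oo)%E).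

Let D : set R := `]0, delta]%classic.

(** Measurability comes from monotonicity: the sets where [phi > r] are intervals. *)
Let mphi : measurable_fun D phi.
Proof.
apply: (measurability _ (ErealGenOInfty.measurableE R)) => _ [_ [r ->] <-].
apply: is_interval_measurable => s t /=.
rewrite /D/= !in_itv/= => -[/andP[s0 sd] _] [/andP[t0 td] /andP[rt _]] x /andP[sx xt].
have x0 := lt_le_trans s0 sx; have xd := le_trans xt td.
rewrite !in_itv/= x0 xd; split => //.
by rewrite andbT (lt_le_trans rt)//; exact: phi_noninc.
Qed.

Let phi_intD : (\int[mu]_(s in D) phi s < +oo)%E.
Proof. by rewrite /D (integral_itv_obnd_cbnd mphi). Qed.

(** An infinite value at [s] would propagate to all of []0, s]] and make the integral infinite. *)
Lemma noninc_fin s : 0 < s -> s <= delta -> (phi s < +oo)%E.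
Proof.
move=> s0 sd; rewrite ltey; apply/eqP => phis.
have : (\int[mu]_(r in `]0%R, s]) phi r <= \int[mu]_(r in D) phi r)%E.
  apply: ge0_subset_integral => //; first exact: measurable_itv.
  by move=> r; rewrite /D/= !in_itv/= => /andP[-> /le_trans]; apply.
have -> : (\int[mu]_(r in `]0%R, s]) phi r = \int[mu]_(r in `]0%R, s]) cst +oo r)%E.
  apply: eq_integral => r; rewrite inE/= in_itv/= => /andP[r0 rs].
  by apply/eqP; rewrite -leye_eq -phis; exact: phi_noninc.
rewrite integral_cst// /= lebesgue_measure_itv/= lte_fin s0 oppr0 adde0.
rewrite gt0_mulye ?lte_fin// leye_eq => /eqP e.
by move: phi_intD; rewrite e ltxx.
Qed.

Let psi s := fine (phi s).

Let phiE s : D s -> phi s = (psi s)%:E.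
Proof.
by rewrite /D/= in_itv/= => /andP[s0 sd]; rewrite fineK// ge0_fin_numE//; exact: noninc_fin.
Qed.

Let mpsi : measurable_fun (`[0, delta]%classic : set R) psi.
Proof.
apply/measurable_fun_itv_obnd_cbndP; apply/measurable_EFinP.
by apply: eq_measurable_fun mphi => s /set_mem Ds; rewrite /= -phiE.
Qed.

Lemma noninc_integrable : mu.-integrable `[0, delta] (EFin \o psi).
Proof.
apply/integrableP; split; first exact/measurable_EFinP.
rewrite -integral_itv_obnd_cbnd; last first.
  apply: measurableT_comp => //; apply/measurable_EFinP.
  exact/measurable_fun_itv_obnd_cbndP.
have -> // : (\int[mu]_(s in `]0%R, delta]) `|(EFin \o psi) s| = \int[mu]_(s in D) phi s)%E.
by apply: eq_integral => s /set_mem Ds; rewrite /= ger0_norm ?fine_ge0// -phiE.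
Qed.

Let ipsi r : r <= delta -> mu.-integrable `[0, r] (EFin \o psi).
Proof.
move=> rd; apply: integrableS noninc_integrable => //.
by move=> s /=; rewrite !in_itv/= => /andP[-> /le_trans]; apply.
Qed.

(** Sampling a nonincreasing function at right endpoints gives a lower sum, so the inequality holds
    for every mesh and no convergence of Riemann sums at the singularity is at stake. The last of
    the [n+1] cells is absent, as in [telescoping], and is discarded by positivity. *)
Lemma riemann_sum_le (h : R) (n : nat) : 0 < h -> h <= delta ->
  \sum_(j < n) h / n.+1%:R * psi (j.+1%:R * (h / n.+1%:R)) <= \int[mu]_(s in `[0, h]) psi s.
Proof.
move=> h0 hd; set eta := h / n.+1%:R.
have eta0 : 0 < eta by rewrite divr_gt0.
have nh : n.+1%:R * eta = h by rewrite mulrC divfK// pnatr_eq0.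
have sub a c : 0 <= a -> a <= c -> c <= delta ->
    \int[mu]_(s in `[0, c]) psi s - \int[mu]_(s in `[0, a]) psi s = \int[mu]_(s in `]a, c]) psi s.
  by move=> a0 ac cd; rewrite Rintegral_itvB ?bnd_simp//; exact: ipsi.
have keh k : (k <= n.+1)%N -> k%:R * eta <= delta.
  by move=> kn; apply: le_trans hd; rewrite -nh ler_pM2r// ler_nat.
have H m : (m <= n)%N -> \sum_(j < m) eta * psi (j.+1%:R * eta) <= \int[mu]_(s in `[0, m%:R * eta]) psi s.
  elim: m => [|m IH] mn.
    by rewrite big_ord0 Rintegral_ge0// => s _; rewrite fine_ge0.
  rewrite big_ord_recr/=; apply: le_trans (lerD (IH (ltnW mn)) (lexx _)) _.
  rewrite -lerBrDl sub; last 3 first.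
  - by rewrite mulr_ge0// ltW.
  - by rewrite ler_pM2r// ler_nat.
  - exact/keh/leqW.
  have -> : eta * psi (m.+1%:R * eta) = \int[mu]_(s in `]m%:R * eta, m.+1%:R * eta]) psi (m.+1%:R * eta).
    rewrite Rintegral_cst// /= lebesgue_measure_itv/= lte_fin ltr_pM2r// ltr_nat ltnSn/=.
    by rewrite -mulrBl -natrB// subSnn mul1r mulrC.
  have me0 : 0 <= m%:R * eta by rewrite mulr_ge0// ltW.
  apply: le_Rintegral => //.
  - apply: measurable_bounded_integrable => //.
    + by rewrite /= lebesgue_measure_itv/=; case: ifP => _; rewrite ?ltry.
    + exists `|psi (m.+1%:R * eta)|; split; first exact: num_real.
      by move=> x Mx t _ /=; exact: ltW.
  - apply: integrableS (ipsi (keh m.+1 (leqW mn))) => //.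
    by move=> s /=; rewrite !in_itv/= => /andP[/ltW/(le_trans me0) -> ->].
  - move=> s /=; rewrite in_itv/= => /andP[s1 s2].
    have s0 := le_lt_trans me0 s1.
    apply: fine_le; last by apply: phi_noninc => //; exact/keh/leqW.
    + rewrite ge0_fin_numE//; apply: noninc_fin; last exact/keh/leqW.
      exact: lt_le_trans s2.
    + rewrite ge0_fin_numE//; apply: noninc_fin => //.
      by apply: le_trans s2 _; exact/keh/leqW.
apply: le_trans (H n (leqnn n)) _.
have ne0 : 0 <= n%:R * eta by rewrite mulr_ge0// ltW.
have neh : n%:R * eta <= h by rewrite -nh ler_pM2r// ler_nat.
by rewrite -subr_ge0 sub// Rintegral_ge0// => s _; rewrite fine_ge0.
Qed.

Lemma noninc_integral_small (t e : R) : 0 < t -> 0 < e ->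
  exists h, [/\ 0 < h, h <= delta, h <= t & \int[mu]_(s in `[0, h]) psi s <= e].
Proof.
move=> t0 e0.
have /cvgrPdist_le/(_ e e0)/nbhs_ballP[r /= r0 hr] := parameterized_integral_cvg_left delta0 noninc_integrable.
pose h := Num.min (r / 2) (Num.min delta t).
have h0 : 0 < h by rewrite !lt_min divr_gt0//= delta0.
exists h; split => //.
- by rewrite !ge_min lexx !orbT.
- by rewrite !ge_min lexx !orbT.
have hlt : h < r.
  by apply: le_lt_trans (_ : r / 2 < r); [rewrite ge_min lexx|rewrite ltr_pdivrMr// ltr_pMr// ltr1n].
have := hr h; rewrite -ball_normE /ball_/= !sub0r !normrN gtr0_norm// => /(_ hlt).
by apply: le_trans; exact: ler_norm.
Qed.

End monotone_integrable.
End monotone_functions.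

(** * The strong Feller property *)

Section strong_feller.
Context {R : realType}.
Local Notation mu := (@lebesgue_measure R).

Lemma uniform_limit_continuous d (v : 'rV[R]_d -> R) :
  (forall e : R, 0 < e -> exists2 u : 'rV[R]_d -> R, continuous u & forall x, `|v x - u x| <= e) ->
  continuous v.
Proof.
move=> H x; apply/(@cvgrPdist_le _ _ _ (nbhs x) (nbhs_filter x)) => e e0.
have e3 : 0 < e / 3 by rewrite divr_gt0.
have [u cu uv] := H _ e3.
have /(@cvgrPdist_le _ _ _ (nbhs x) (nbhs_filter x))/(_ _ e3) := cu x.
apply: filterS => y hy.
have -> : v x - v y = (v x - u x) + (u x - u y) - (v y - u y) by ring.
apply: le_trans (ler_normB _ _) _; apply: le_trans (lerD (ler_normD _ _) (lexx _)) _.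
have := uv x; have := uv y.
by move: hy; move: `|u x - u y| `|v x - u x| `|v y - u y| => *; lra.
Qed.

Lemma continuous_affine d (u v : 'rV[R]_d -> R) (c : R) :
  continuous u -> continuous v -> continuous (fun x => u x + c * v x).
Proof.
move=> cu cv x.
by apply: (@continuousD _ _ _ u (fun x => c * v x)); [exact: cu|apply: (@continuousM _ _ (fun=> c) v); [exact: cst_continuous|exact: cv]].
Qed.

(** The sum counts the natural numbers below [a], so it is the ceiling of [a]. The induction carries
    along the case [n <= a], where every term is 1. *)
Lemma sum_indic_lt (a : R) (n : nat) : 0 <= a -> a <= n%:R ->
  a <= \sum_(k < n) (k%:R < a)%R%:R <= a + 1.
Proof.
move=> a0; suff [_ h] : (n%:R <= a -> \sum_(k < n) (k%:R < a)%R%:R = n%:R :> R) /\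
    (a <= n%:R -> a <= \sum_(k < n) (k%:R < a)%R%:R <= a + 1) by exact: h.
elim: n => [|n [IH1 IH2]].
  rewrite big_ord0; split => // a1; apply/andP; split => //.
  by apply: le_trans a0 _; rewrite lerDl.
rewrite big_ord_recr/=; have [na|an] := ltP n%:R a.
  rewrite (IH1 (ltW na)) -[true%:R]/(1 : R) natr1; split => // an1; rewrite an1/= -natr1 lerD2r.
  exact: ltW.
rewrite -[false%:R]/(0 : R) addr0; split; last by move=> _; exact: IH2.
move=> na; have := le_trans na an; rewrite ler_nat ltnn //.
Qed.

Section semigroup.
Context {d : nat} {dO : 'rV[R]_d -> measure_display} {Om : forall x, measurableType (dO x)}
  (Px : forall x, probability (Om x) R) (X : forall x, R -> Om x -> 'rV[R]_d) (t : R).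
Hypothesis rX : forall x, rvec (@X x t).
Implicit Types f g : 'rV[R]_d -> R.

Lemma PX_bounded f (M : R) x : measurable_fun setT (f : borel_rV R d -> R) -> (forall z, `|f z| <= M) ->
  `|PX Px X t f x| <= M.
Proof.
move=> mf fM; rewrite /PX -/(Rintegral _ _ _); apply: norm_expectation_le_bound => //.
exact: (rvec_comp mf (rX x)).
Qed.

Lemma PX_affine f g (M a : R) : measurable_fun setT (f : borel_rV R d -> R) -> measurable_fun setT (g : borel_rV R d -> R) ->
  (forall z, `|f z| <= M) -> (forall z, `|g z| <= M) ->
  PX Px X t (fun z => f z + a * g z) = fun x => PX Px X t f x + a * PX Px X t g x.
Proof.
move=> mf mg fM gM; apply/funext => x; rewrite /PX -!/(Rintegral _ _ _).
have ig : (Px x).-integrable setT (EFin \o (fun w => g (@X x t w))).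
  by apply: (bounded_integrable _ (rvec_comp mg (rX x)) (M := M)).
rewrite RintegralD//; first by rewrite RintegralZl.
- by apply: (bounded_integrable _ (rvec_comp mf (rX x)) (M := M)).
- exact: (@integrableZl _ _ _ (Px x) setT measurableT a _ ig).
Qed.

Lemma PX_indic (B : set 'rV[R]_d) : borelV d B -> PX Px X t \1_B = fun x => fine (Px x (@X x t @^-1` B)).
Proof.
move=> bB; apply/funext => x; rewrite -(Rexpectation_indic (Px x)); last exact: rX.
by [].
Qed.

(** A layer-cake sum of indicators of the sets where [f] exceeds [-M + k c] approximates [f] within
    [c], uniformly. Averaging preserves this error, so [PX f] is a uniform limit of continuous
    functions. *)
Lemma strong_Feller_indic :
  (forall B, borelV d B -> continuous (PX Px X t \1_B)) -> strong_Feller (PX Px X t).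
Proof.
move=> H f /BbP[[M0 fM0] mf].
pose M := `|M0| + 1.
have M1 : 0 < M by rewrite ltr_wpDl.
have fM z : `|f z| <= M by apply: le_trans (fM0 z) _; rewrite (le_trans (ler_norm _))// lerDl.
split; last by exists M => x; exact: PX_bounded.
have m1 (B : set 'rV[R]_d) : borelV d B -> measurable_fun setT (\1_B : borel_rV R d -> R) by move=> bB; exact: measurable_indic.
have i1 (B : set 'rV[R]_d) z : `|\1_B z : R| <= 1.
  by rewrite indicE; case: (_ \in _); rewrite ?normr1 ?normr0.
apply: uniform_limit_continuous => e e0.
have [n _ hn] := near_infty_natSinv_lt (PosNum (divr_gt0 e0 (mulr_gt0 (ltr0n R 2) M1))).
have {hn} := hn n (leqnn n) => /= hn.
(* The [n+1] levels of height [c] fill the range [[-M, M]] of [f], and [n] was chosen so that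
   [c <= e]. *)
pose c := 2 * M / n.+1%:R.
have c0 : 0 < c by rewrite divr_gt0// mulr_gt0.
have ce : c <= e.
  by rewrite /c mulrC -ler_pdivlMr ?mulr_gt0// ltW.
pose a z := (f z + M) / c.
pose B (k : nat) := [set z : 'rV[R]_d | k%:R < a z].
have bB k : borelV d (B k).
  have ma : measurable_fun setT (a : borel_rV R d -> R).
    by apply: measurable_funM => //; exact: measurable_funD.
  have := ma measurableT _ (measurable_itv `]k%:R, +oo[); rewrite setTI.
  by congr borelV; apply/seteqP; split => z /=; rewrite in_itv/= andbT.
pose S N z := - M + c * \sum_(k < N) \1_(B k) z.
have mS N : measurable_fun setT (S N : borel_rV R d -> R).
  apply: measurable_funD => //; apply: measurable_funM => //.
  by apply: measurable_sum => k; exact: m1.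
have bS N z : `|S N z| <= M + c * N%:R.
  apply: le_trans (ler_normD _ _) _; rewrite normrN (gtr0_norm M1) lerD2l normrM (gtr0_norm c0) ler_pM2l//.
  apply: le_trans (ler_norm_sum _ _ _) _.
  by rewrite -[leRHS]mulr1 mulr_natl -[X in _ *+ X](card_ord N) -sumr_const ler_sum.
have cS N : continuous (PX Px X t (S N)).
  elim: N => [|N IH].
    have -> : PX Px X t (S 0%N) = fun=> - M.
      apply/funext => x; rewrite /PX -/(Rintegral _ _ _) -[RHS](Rexpectation_cst (Px x)).
      by apply: eq_Rintegral => w _; rewrite /S big_ord0 mulr0 addr0.
    exact: cst_continuous.
  have -> : S N.+1 = fun z => S N z + c * \1_(B N) z.
    by apply/funext => z; rewrite /S big_ord_recr/= mulrDr addrA.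
  rewrite (@PX_affine _ _ (M + c * N%:R + 1))//; last 3 first.
  - exact: m1.
  - by move=> z; apply: le_trans (bS N z) _; rewrite lerDl.
  - by move=> z; apply: le_trans (i1 _ _) _; rewrite lerDr addr_ge0// ?mulr_ge0// ltW.
  by apply: continuous_affine => //; exact: H.
exists (PX Px X t (S n.+1)) => // x.
rewrite /PX -!/(Rintegral _ _ _).
apply: (@expectation_dist _ _ _ (Px x) _ _ (M + c * n.+1%:R)).
- exact: (rvec_comp mf (rX x)).
- exact: (rvec_comp (mS _) (rX x)).
- by move=> w; apply: le_trans (fM _) _; rewrite lerDl mulr_ge0// ltW.
- by move=> w; exact: bS.
apply: aeW => w; set z := @X x t w.
have cn : c * n.+1%:R = 2 * M by rewrite /c divfK// pnatr_eq0.
have fz : f z = - M + c * a z by rewrite /a mulrC divfK ?gt_eqF//; ring.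
have := fM z; rewrite ler_norml => /andP[f1 f2].
have a0 : 0 <= a z by apply: divr_ge0; [rewrite -lerBlDr sub0r|exact: ltW].
have an : a z <= n.+1%:R by rewrite /a ler_pdivrMr// mulrC cn mulr_natl mulr2n lerD2r.
have := sum_indic_lt a0 an.
have -> : \sum_(k < n.+1) (k%:R < a z)%R%:R = \sum_(k < n.+1) \1_(B k) z :> R.
  apply: eq_bigr => k _; rewrite indicE; congr (nat_of_bool _)%:R.
  by apply/idP/idP => [h|/set_mem//]; exact/mem_set.
rewrite {1}fz /S; move: (\sum_(k < n.+1) _) => s /andP[s1 s2].
have -> : - M + c * a z - (- M + c * s) = - (c * (s - a z)) by ring.
rewrite normrN normrM (gtr0_norm c0) ger0_norm ?subr_ge0//.
apply: le_trans ce; rewrite -[leRHS]mulr1 ler_pM2l//; lra.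
Qed.

End semigroup.

Section main.
Context {d : nat} {d0 : measure_display} {Om0 : measurableType d0} (P0 : probability Om0 R)
  (W : R -> Om0 -> 'rV[R]_d) (T : R -> Om0 -> R) (xi : R -> Om0 -> 'rV[R]_d).
Hypotheses (HW : wiener P0 W) (HT : subordinator P0 T)
  (HWT : indep_events P0 (fd_event (@measurable _ R) T) (fd_event (borelV d) W))
  (HYrv : rv_process (borelV d) (fun t w => W (T t w) w))
  (Hxi : levy_process P0 (borelV d) xi)
  (HxiY : indep_events P0 (fd_event (borelV d) xi) (fd_event (borelV d) (fun t w => W (T t w) w))).

Let Z t w := W (T t w) w + xi t w.
Let phi s := (\int[P0]_w ((Num.sqrt (T s w))^-1)%:E)%E.

Let fd_event1 (U : normedModType R) (M : set (set U)) (Y : R -> Om0 -> U) s B : 0 <= s -> M B ->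
  fd_event M Y (Y s @^-1` B).
Proof.
move=> s0 MB; exists 1%N, (fun=> s), (fun=> B); split => //; split => //.
by rewrite bigcap_mkord big_ord1.
Qed.

Let mT s : 0 <= s -> measurable_fun setT (T s).
Proof.
by case: HT => -[rT _ _] _ s0 _ B mB; rewrite setTI; exact: rT.
Qed.

Let rxi s : 0 <= s -> rvec (xi s).
Proof. by case: Hxi => rx _ _ s0 B; exact: rx. Qed.

Let rY s : 0 <= s -> rvec (fun w => W (T s w) w).
Proof. by move=> s0 B bB; exact: (HYrv s0 bB). Qed.

Lemma driving_noise_rvec s : 0 <= s -> rvec (Z s).
Proof. by move=> s0; apply: rvecD; [exact: rY|exact: rxi]. Qed.

Let mphi s : 0 <= s -> measurable_fun setT (fun w => ((Num.sqrt (T s w))^-1)%:E).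
Proof.
move=> s0; apply/measurable_EFinP; exact: (measurableT_comp measurable_inv_sqrt (mT s0)).
Qed.

Lemma inv_sqrt_moment_ge0 s : (0 <= phi s)%E.
Proof. by apply: integral_ge0 => w _; rewrite lee_fin invr_ge0 sqrtr_ge0. Qed.

Lemma inv_sqrt_moment_noninc s t : 0 < s -> s <= t -> (phi t <= phi s)%E.
Proof.
move=> s0 st; have t0 := lt_le_trans s0 st.
apply: ae_ge0_le_integral => //.
- exact/mphi/ltW.
- exact/mphi/ltW.
case: HT => _; apply: filterS => w [_ mono pos] _.
rewrite lee_fin lef_pV2 ?posrE ?sqrtr_gt0 ?pos// ler_sqrt; last exact/ltW/pos.
by apply: mono => //; exact: ltW.
Qed.

(** Independence of [xi] from the subordinated process allows [xi] to be frozen; its value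
    translates both points alike and cancels in [x - y]. What remains is [subordinated_lipschitz]
    with [tau = T s]. *)
Lemma noise_lipschitz s g K : 0 < s -> (phi s < +oo)%E -> lipschitz_fun K g -> (forall z, `|g z| <= 1) ->
  lipschitz_fun (9 * d.+1%:R * fine (phi s)) (conv_sg P0 Z s g).
Proof.
move=> s0 phis lg g1 x y; have s0' := ltW s0.
have indepE v : conv_sg P0 Z s g v = \int[P0]_w \int[P0]_w' g ((v + xi s w) + W (T s w') w').
  have mg : measurable_fun setT ((fun z => g (v + z)) : borel_rV R d -> R).
    by apply: (@lipschitz_borelV _ _ K); exact: lipschitz_shift.
  have h A B : borelV d A -> borelV d B -> P0 (xi s @^-1` A `&` (fun w => W (T s w) w) @^-1` B) =
      (P0 (xi s @^-1` A) * P0 ((fun w => W (T s w) w) @^-1` B))%E.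
    move=> bA bB; apply: HxiY; first exact: fd_event1.
    exact: (@fd_event1 _ (borelV d) (fun t w => W (T t w) w)).
  have := expectation_indepD (rxi s0') (rY s0') h mg (fun z => g1 _).
  under [X in _ = X -> _]eq_Rintegral do under eq_Rintegral do rewrite addrA.
  by move=> <-; apply: eq_Rintegral => w _; rewrite /Z [W _ _ + _]addrC.
rewrite !indepE.
have mg v := @measurable_fun_rvecD R d _ Om0 _ Om0 (fun w => v + xi s w) (fun w => W (T s w) w) g
  (lipschitz_borelV lg) (rvecD (rvec_cst Om0 v) (rxi s0')) (rY s0').
have [mx _] := fubini_expectation P0 P0 (mg x) (fun z => g1 _).
have [my _] := fubini_expectation P0 P0 (mg y) (fun z => g1 _).
have b1 v w : `|\int[P0]_w' g ((v + xi s w) + W (T s w') w')| <= 1.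
  apply: norm_expectation_le_bound => //; apply: (rvec_comp (lipschitz_borelV lg)).
  by apply: rvecD; [exact: rvec_cst|exact: rY].
apply: (expectation_dist mx my (b1 x) (b1 y)); apply: aeW => w.
have tau0 : {ae P0, forall w, 0 < T s w}.
  by case: HT => _; apply: filterS => w' [_ _]; apply.
have ind t A B : 0 <= t -> measurable A -> borelV d B ->
    P0 (T s @^-1` A `&` W t @^-1` B) = (P0 (T s @^-1` A) * P0 (W t @^-1` B))%E.
  by move=> t0 mA bB; apply: HWT; exact: fd_event1.
apply: le_trans (subordinated_lipschitz HW (mT s0') tau0 ind (rY s0') (x + xi s w) (y + xi s w) lg g1 phis) _.
by rewrite opprD addrACA subrr addr0 mulrAC.
Qed.

(** The constant in [noise_lipschitz] does not depend on the test function, so [lipschitz_tv], with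
    a bound proportional to [|x - y|], extends it to indicators. *)
Lemma noise_indic_Cb s B : 0 < s -> (phi s < +oo)%E -> borelV d B -> Cb (conv_sg P0 Z s \1_B).
Proof.
move=> s0 phis bB; have s0' := ltW s0.
have rs x := rvec_shift driving_noise_rvec x s0'.
have E x : conv_sg P0 Z s \1_B x = fine (P0 ((fun w => x + Z s w) @^-1` B)).
  by rewrite -Rexpectation_indic//; exact: rs.
split; last first.
  exists 1 => x; rewrite E ger0_norm ?fine_ge0// -lee_fin fineK ?fin_num_measure//; last exact: rs.
  by apply: probability_le1; exact: rs.
apply: (@lipschitz_fun_continuous _ _ (9 * d.+1%:R * fine (phi s))) => x y; rewrite !E.
apply: (lipschitz_tv (rs x) (rs y)) => // G L lG G01.
apply: (noise_lipschitz s0 phis lG) => z.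
by have /andP[? ?] := G01 z; rewrite ger0_norm.
Qed.

Section solution.
Context (b : 'rV[R]_d -> 'rV[R]_d)
  (dO : 'rV[R]_d -> measure_display) (Om : forall x, measurableType (dO x))
  (Px : forall x, probability (Om x) R) (F : forall x, R -> set (set (Om x)))
  (Z' : forall x, R -> Om x -> 'rV[R]_d) (X : forall x, R -> Om x -> 'rV[R]_d).
Hypotheses (Hsol : markov_weak_solutions b P0 Z Px F Z' X)
  (HFeller : forall t, 0 <= t -> Feller (PX Px X t)).
Variables (delta : R) (M : R).
Hypotheses (Hdelta : 0 < delta)
  (Hint : (\int[mu]_(s in `[0%R, delta]) phi s < +oo)%E)
  (cb : continuous b) (bM : forall z, `|b z| <= M).

Let rX x s : 0 <= s -> rvec (@X x s).
Proof.
move=> s0; have [FF _ _ [aX _ _ _]] := Hsol x.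
by move=> B bB; case: FF => _ FS _; apply: (FS s); exact: aX.
Qed.

Let noninc s t : 0 < s -> s <= t -> t <= delta -> (phi t <= phi s)%E.
Proof. by move=> s0 st _; exact: inv_sqrt_moment_noninc. Qed.

Let C : R := 9 * d.+1%:R.
Let I h := \int[mu]_(s in `[0, h]) fine (phi s).

(** [telescoping] and [riemann_sum_le] hold for every [n]; letting [n] tend to infinity removes the
    term with the Lipschitz constant of [G]. *)
Lemma weak_solution_lipschitz_close x t h G L : 0 < h -> h <= delta -> h <= t ->
  lipschitz_fun L G -> (forall z, `|G z| <= 1) ->
  `|\int[Px x]_w G (@X x t w) - \int[Px x]_w conv_sg P0 Z h G (@X x (t - h) w)| <= M * (C * I h).
Proof.
move=> h0 hd ht lG G1.
have [FF FZ law [aX cX sde _]] := Hsol x.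
have M0 : 0 <= M by apply: le_trans (bM 0).
have lG' : lipschitz_fun `|L| G.
  by move=> u v; apply: le_trans (lG u v) _; rewrite ler_wpM2r// ler_norm.
have fin s : 0 < s -> s <= delta -> (phi s < +oo)%E.
  exact: (noninc_fin inv_sqrt_moment_ge0 noninc Hint).
have lip s : 0 < s -> s <= h -> lipschitz_fun (C * fine (phi s)) (conv_sg P0 Z s G).
  by move=> s0 sh; apply: (noise_lipschitz s0 _ lG G1); apply: fin => //; exact: le_trans hd.
have C0 : 0 <= C by rewrite mulr_ge0.
have psi0 s : 0 <= fine (phi s) by rewrite fine_ge0// inv_sqrt_moment_ge0.
have tel n := telescoping driving_noise_rvec FF FZ law cb bM aX cX sde C0 (normr_ge0 L) lG' G1 h0 ht psi0 lip n.
set A := `|_ - _| in tel *.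
have cv : M * (`|L| * h * n.+1%:R^-1 + C * I h) @[n --> \oo] --> M * (`|L| * h * 0 + C * I h).
  apply: cvgM; first exact: cvg_cst.
  apply: cvgD; last exact: cvg_cst.
  by apply: cvgM; [exact: cvg_cst|exact: cvg_harmonic].
rewrite mulr0 add0r in cv.
apply: (cvgr_to_ge cv); apply: nearW => n; apply: le_trans (tel n) _.
rewrite ler_wpM2l// mulrA lerD2l ler_wpM2l//.
exact: (riemann_sum_le inv_sqrt_moment_ge0 noninc Hint).
Qed.

Lemma weak_solution_tv_close x t h B : 0 < h -> h <= delta -> h <= t -> borelV d B ->
  `|PX Px X t \1_B x - PX Px X (t - h) (conv_sg P0 Z h \1_B) x| <= M * (C * I h).
Proof.
move=> h0 hd ht bB.
have t0 : 0 <= t := le_trans (ltW h0) ht.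
have th0 : 0 <= t - h by rewrite subr_ge0.
have rXh := rX x th0; have rZh := driving_noise_rvec (ltW h0).
(* On the product space [V2] is [X (t - h)] plus an independent copy of the noise at time [h]. This
   expresses the smoothed term through the law of one random vector, as [lipschitz_tv] requires. *)
pose V2 (z : Om x * Om0) := @X x (t - h) z.1 + Z h z.2.
have rV2 : rvec V2.
  apply: rvecD.
  - by apply: (rvec_measurableT_comp rXh); exact: measurable_fst.
  - by apply: (rvec_measurableT_comp rZh); exact: measurable_snd.
have fub (G : 'rV[R]_d -> R) (c : R) : measurable_fun setT (G : borel_rV R d -> R) -> (forall z, `|G z| <= c) ->
    \int[(Px x \x P0)%E]_z G (V2 z) = \int[Px x]_w conv_sg P0 Z h G (@X x (t - h) w).
  move=> mG Gc.
  by have [_ ->] := fubini_expectation (Px x) P0 (measurable_fun_rvecD mG rXh rZh) (fun z => Gc _).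
have -> : PX Px X t \1_B x = fine (Px x (@X x t @^-1` B)) by rewrite (PX_indic Px (fun x => rX x t0) bB).
have -> : PX Px X (t - h) (conv_sg P0 Z h \1_B) x = fine ((Px x \x P0)%E (V2 @^-1` B)).
  rewrite -[RHS]Rexpectation_indic; last exact: rV2.
  apply/esym; apply: (fub \1_B 1); first exact: measurable_indic.
  by move=> z; rewrite indicE; case: (_ \in _); rewrite ?normr1 ?normr0.
apply: (lipschitz_tv (rX x t0) rV2) => // G L lG G01.
have G1 z : `|G z| <= 1 by have /andP[? ?] := G01 z; rewrite ger0_norm.
rewrite (fub G 1)//; last exact: lipschitz_borelV lG.
exact: weak_solution_lipschitz_close lG G1.
Qed.

Lemma weak_solution_strong_Feller t : 0 < t -> strong_Feller (PX Px X t).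
Proof.
move=> t0; apply: strong_Feller_indic => [x|B bB]; first exact/rX/ltW.
apply: uniform_limit_continuous => e e0.
have M0 : 0 <= M by apply: le_trans (bM 0).
have MC0 : 0 <= M * C by rewrite mulr_ge0// mulr_ge0.
(* The added 1 avoids a division by zero when [M] is 0. *)
have e1 : 0 < e / (M * C + 1) by rewrite divr_gt0// ltr_wpDl.
have [h [h0 hd ht hI]] := noninc_integral_small Hdelta inv_sqrt_moment_ge0 noninc Hint t0 e1.
exists (PX Px X (t - h) (conv_sg P0 Z h \1_B)).
  (* The choice [h = t] is possible; the Feller property is then used at time 0. *)
  have th0 : 0 <= t - h by rewrite subr_ge0.
  have phih : (phi h < +oo)%E by exact: (noninc_fin inv_sqrt_moment_ge0 noninc Hint).
  by have [] := HFeller th0 (noise_indic_Cb h0 phih bB).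
move=> x; apply: le_trans (weak_solution_tv_close x h0 hd ht bB) _.
rewrite mulrA; apply: (@le_trans _ _ (M * C * (e / (M * C + 1)))); first exact: ler_wpM2l.
rewrite mulrCA; apply: ler_piMr; first exact: ltW.
by rewrite ler_pdivrMr ?mul1r ?lerDl// ltr_wpDl.
Qed.

End solution.
End main.
End strong_feller.

Theorem theorem4p3 (R : realType) (d : nat)
  (* the probability space carrying W, T, xi *)
  (d0 : measure_display) (Om0 : measurableType d0) (P0 : probability Om0 R)
  (W : R -> Om0 -> 'rV[R]_d) (T : R -> Om0 -> R) (xi : R -> Om0 -> 'rV[R]_d)
  (HW : wiener P0 W)
  (HT : subordinator P0 T)
  (HWT : indep_events P0 (fd_event (@measurable _ R) T) (fd_event (borelV d) W))
  (HYrv : rv_process (borelV d) (fun t w => W (T t w) w))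
  (Hxi : levy_process P0 (borelV d) xi)
  (HxiY : indep_events P0 (fd_event (borelV d) xi)
                          (fd_event (borelV d) (fun t w => W (T t w) w)))
  (* the drift and the standing assumption *)
  (b : 'rV[R]_d -> 'rV[R]_d)
  (dO : 'rV[R]_d -> measure_display) (Om : forall x, measurableType (dO x))
  (Px : forall x, probability (Om x) R) (F : forall x, R -> set (set (Om x)))
  (Z' : forall x, R -> Om x -> 'rV[R]_d) (X : forall x, R -> Om x -> 'rV[R]_d)
  (Hsol : markov_weak_solutions b P0 (fun t w => W (T t w) w + xi t w) Px F Z' X)
  (HFeller : forall t, 0 <= t -> Feller (PX Px X t))
  (* hypotheses of the theorem *)
  (delta : R) (Hdelta : 0 < delta)
  (Hint : (\int[@lebesgue_measure R]_(s in `[0%R, delta])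
             (\int[P0]_w ((Num.sqrt (T s w))^-1)%:E) < +oo)%E)
  (Hb : Cb b) :
  forall t, 0 < t -> strong_Feller (PX Px X t).
Proof.
case: Hb => cb [M bM] t t0.
exact: (weak_solution_strong_Feller HW HT HWT HYrv Hxi HxiY Hsol HFeller Hdelta Hint cb bM t0).
Qed.
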